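(* Let $X$ be a countable set and let $G$ be a topological subgroup of $\mathrm{Sym}(X)$. Then the following hold. (1) If the topological group $G$ is amenable, then the action of $G$ on $\{gB\mid g\in G\}$ is Liouville for every finite subset $B\subseteq X$. (2) If $G$ preserves a linear order on $X$ and the action of $G$ on $\{gB\mid g\in G\}$ is Liouville for every finite subset $B\subseteq X$, then the topological group $G$ is amenable.
   Context: $\mathrm{Sym}(X)$ is the full symmetric group of $X$ with the topology of pointwise convergence ($X$ discrete), and $G$ carries the subspace topology. $G$ acts on subsets of $X$ by $gB=\{gx\mid x\in B\}$. For a topological group $G$ and $g\in G$ let $\lambda_g(x)=gx$. A function $f\colon G\to\mathbb{C}$ is right-uniformly continuous if for every $\varepsilon>0$ there is a neighbourhood $U$ of the neutral element such that $|f(x)-f(y)|\le\varepsilon$ whenever $xy^{-1}\in U$; $\mathrm{RUCB}(G)$ is the $C^*$-algebra of all bounded such functions with supremum norm, and $\mathrm{M}(G)$ is the set of its states (positive linear functionals $\mu$ with $\mu(\mathbf 1)=1$). $G$ is amenable if there is $\mu\in\mathrm{M}(G)$ with $\mu(f\circ\lambda_g)=\mu(f)$ for all $f\in\mathrm{RUCB}(G)$, $g\in G$. A Borel probability measure $\mu$ on $G$ is regular if $\mu(B)=\sup\{\mu(K)\mid K\subseteq B \text{ compact}\}$ for every Borel $B\subseteq G$, and non-degenerate if its support $\mathrm{spt}(\mu)=\{x\in G\mid \mu(U)>0 \text{ for all open } U\ni x\}$ generates a dense subsemigroup of $G$. Let $G$ act continuously on a set $Y$ regarded as a discrete metric space (all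 distances between distinct points equal to $1$). A bounded function $f\colon Y\to\mathbb{R}$ is $\mu$-harmonic if $f(y)=\int f(gy)\,d\mu(g)$ for all $y\in Y$. The action is $\mu$-Liouville if every $\mu$-harmonic bounded function $Y\to\mathbb{R}$ is constant, and Liouville if it is $\nu$-Liouville for some non-degenerate, regular Borel probability measure $\nu$ on $G$. *)

(* Defs.v *)
From HB Require Import structures.
From mathcomp Require Import all_boot all_order all_algebra.
From mathcomp Require Import finmap complex.
From mathcomp Require Import all_classical all_reals all_analysis.

Set Implicit Arguments.
Unset Strict Implicit.
Unset Printing Implicit Defensive.

Import Order.TTheory GRing.Theory Num.Theory.
Import numFieldNormedType.Exports.

Local Open Scope classical_set_scope.
Local Open Scope group_scope.

(* [Pointed] is only there because [measurableType] requires it. *)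
HB.mixin Record isTopGroup G of Group G & Topological G := {
  mulg_continuous : continuous (fun p : G * G => (p.1 * p.2)%g);
  invg_continuous : continuous (fun x : G => (x^-1)%g)
}.

#[short(type="topGroupType")]
HB.structure Definition TopGroup :=
  { G of Group G & Topological G & Pointed G & isTopGroup G }.

Section sym.
Variable X : choiceType.

Record Sym : Type :=
  MkSym { sym_fun :> X -> X; _ : `[< bijective sym_fun >] }.

HB.instance Definition _ := [isSub for sym_fun].
HB.instance Definition _ := [Choice of Sym by <:].

Implicit Types g h : Sym.

Lemma sym_bij g : bijective (val g).
Proof. exact/asboolP/(valP g). Qed.

Lemma sym_inv_proof g :
  exists f : X -> X, cancel (val g) f /\ cancel f (val g).
Proof. by have [f] := sym_bij g; exists f. Qed.

Definition sym_inv_fun g : X -> X := projT1 (cid (sym_inv_proof g)).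

Lemma sym_funK g : cancel (val g) (sym_inv_fun g).
Proof. by rewrite /sym_inv_fun; case: cid => f []. Qed.

Lemma sym_invK g : cancel (sym_inv_fun g) (val g).
Proof. by rewrite /sym_inv_fun; case: cid => f []. Qed.

Definition mkSym f (fP : bijective f) : Sym := MkSym (asboolT fP).

Lemma id_bij : bijective (@id X).
Proof. by exists id. Qed.

Definition sym_one : Sym := mkSym id_bij.
Definition sym_mul g h : Sym := mkSym (bij_comp (sym_bij g) (sym_bij h)).
Definition sym_inv g : Sym := mkSym (Bijective (sym_invK g) (sym_funK g)).

Fact sym_mulA : associative sym_mul.
Proof. by move=> f g h; exact: val_inj. Qed.
Fact sym_mul1 : left_id sym_one sym_mul.
Proof. by move=> g; exact: val_inj. Qed.
Fact sym_1mul : right_id sym_one sym_mul.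
Proof. by move=> g; exact: val_inj. Qed.
Fact sym_mulV : left_inverse sym_one sym_inv sym_mul.
Proof. by move=> g; apply/val_inj/funext => x; exact: sym_funK. Qed.
Fact sym_Vmul : right_inverse sym_one sym_inv sym_mul.
Proof. by move=> g; apply/val_inj/funext => x; exact: sym_invK. Qed.

HB.instance Definition _ :=
  isGroup.Build Sym sym_mulA sym_mul1 sym_1mul sym_mulV sym_Vmul.
HB.instance Definition _ := isPointed.Build Sym 1.

Definition sym_ptws g : {ptws X -> discrete_topology X} := val g.

HB.instance Definition _ := Topological.copy Sym (initial_topology sym_ptws).

Lemma sym_nbhs_eval g x : nbhs g [set h : Sym | val h x = val g x].
Proof.
have c : continuous (fun h : Sym => sym_ptws h x : discrete_topology X).
  move=> h; apply: (@continuous_comp _ _ _ sym_ptws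
    (fun f : {ptws X -> discrete_topology X} => f x)).
    exact: initial_continuous.
  exact: (@proj_continuous X (fun=> discrete_topology X)).
exact: (c g _ (discrete_set1 (val g x : discrete_topology X))).
Qed.

Lemma sym_cvg (F : set_system Sym) g : Filter F ->
  (forall x, F [set h : Sym | val h x = val g x]) -> F --> g.
Proof.
move=> FF Fg.
have : (sym_ptws @ F) --> sym_ptws g.
  apply/cvg_sup => x A [_ [[B oB <-]] /= Bg BA].
  suff : F (sym_ptws @^-1` A) by [].
  apply: filterS (Fg x) => h hg; apply: BA.
  by rewrite /= /sym_ptws (hg : val h x = val g x).
move=> cF A; rewrite nbhsE => -[_ [[B oB <-] Bg] BA].
have : nbhs (sym_ptws g) B by apply: open_nbhs_nbhs.
by move=> /cF FB; apply: (@filterS _ F _ _ _ _ FB) => h; exact: BA.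
Qed.

Fact sym_mul_continuous : continuous (fun p : Sym * Sym => (p.1 * p.2)%g).
Proof.
move=> [g h]; apply: sym_cvg => x; exists
  ([set g' : Sym | val g' (val h x) = val g (val h x)],
   [set h' : Sym | val h' x = val h x]).
  by split; exact: sym_nbhs_eval.
by move=> [g' h'] [/= g'E h'E]; rewrite /= h'E.
Qed.

Fact sym_inv_continuous : continuous (fun g : Sym => (g^-1)%g).
Proof.
move=> g; apply: (@sym_cvg _ (g^-1)%g (fmap_filter _ (nbhs_filter g))) => x.
suff : \forall h \near g, sym_inv h x = sym_inv g x by [].
apply: filterS (sym_nbhs_eval g (sym_inv_fun g x)) => h hE.
by apply: (can_inj (sym_funK h)); rewrite hE !sym_invK.
Qed.

HB.instance Definition _ :=
  isTopGroup.Build Sym sym_mul_continuous sym_inv_continuous.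

End sym.

(* A subgroup with the subspace topology. *)
Section subgroup.
Variables (T : topGroupType) (S : groupClosed T).

Record subgroup : Type :=
  MkSubgroup { subgroup_val : T; _ : subgroup_val \in S }.

HB.instance Definition _ := [isSub for subgroup_val].
HB.instance Definition _ := [Choice of subgroup by <:].

Fact subgroup_closed : group_closed S.
Proof. by split; [exact: gpred1 | exact: gpredF]. Qed.

HB.instance Definition _ :=
  SubChoice_isSubGroup.Build T _ subgroup subgroup_closed.
HB.instance Definition _ := isPointed.Build subgroup 1.

HB.instance Definition _ :=
  Topological.copy subgroup (initial_topology subgroup_val).

Lemma subgroup_val_continuous : continuous subgroup_val.
Proof. exact: initial_continuous. Qed.

Lemma subgroup_cvg (F : set_system subgroup) (g : subgroup) : Filter F ->
  (subgroup_val @ F) --> subgroup_val g -> F --> g.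
Proof.
move=> FF cF A; rewrite nbhsE => -[_ [[B oB <-] Bg] BA].
have : nbhs (subgroup_val g) B by apply: open_nbhs_nbhs.
by move=> /cF FB; apply: (@filterS _ F _ _ _ _ FB) => h; exact: BA.
Qed.

Fact subgroup_mul_continuous :
  continuous (fun p : subgroup * subgroup => (p.1 * p.2)%g).
Proof.
move=> [g h]; apply: subgroup_cvg.
have c : {for (g, h), continuous
    (fun p : subgroup * subgroup => subgroup_val p.1 * subgroup_val p.2)%g}.
  apply: (@continuous_comp _ _ _
    (fun p : subgroup * subgroup => (subgroup_val p.1, subgroup_val p.2))
    (fun p : T * T => (p.1 * p.2)%g)); last exact: mulg_continuous.
  apply: cvg_pair; apply: continuous_comp; try exact: subgroup_val_continuous.
    exact: cvg_fst.
  exact: cvg_snd.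
exact: c.
Qed.

Fact subgroup_inv_continuous : continuous (fun g : subgroup => (g^-1)%g).
Proof.
move=> g; apply: (@subgroup_cvg _ (g^-1)%g (fmap_filter _ (nbhs_filter g))).
have c : {for g, continuous (fun h : subgroup => (subgroup_val h)^-1)%g}.
  apply: (@continuous_comp _ _ _ subgroup_val (fun x : T => (x^-1)%g)).
    exact: subgroup_val_continuous.
  exact: invg_continuous.
exact: c.
Qed.

HB.instance Definition _ :=
  isTopGroup.Build subgroup subgroup_mul_continuous subgroup_inv_continuous.

End subgroup.

Section rucb.
Variables (R : realType) (G : topGroupType).
Local Open Scope ring_scope.
Local Open Scope complex_scope.

Definition right_unif_continuous (f : G -> R[i]) :=
  forall e : R, 0 < e -> exists2 U : set G, nbhs (1%g : G) U &
    forall x y : G, U (x * y^-1)%g -> `|f x - f y| <= e%:C.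

Definition bounded_function (f : G -> R[i]) :=
  exists M : R, forall x, `|f x| <= M%:C.

Definition rucb_pred : {pred G -> R[i]^o} :=
  fun f => `[< right_unif_continuous f /\ bounded_function f >].

Fact rucb_submod_closed : submod_closed rucb_pred.
Proof.
split.
  apply/asboolP; split.
    move=> e e0; exists setT; first exact: filterT.
    by move=> x y _; rewrite subrr normr0 ler0c ltW.
  by exists 0 => x; rewrite normr0.
move=> a f h /asboolP[cf [M Mf]] /asboolP[ch [N Nh]]; apply/asboolP; split.
  have [b b0 ab] : exists2 b : R, 0 < b & `|a| <= b%:C.
    exists (complex.Re `|a| + 1).
      by rewrite ltr_wpDl// normc_def /= sqrtr_ge0.
    by rewrite normc_def /= lecR lerDl.
  move=> e e0.
  have [U U1 Uf] := cf (e / 2 / b) (divr_gt0 (divr_gt0 e0 (ltr0Sn _ 1)) b0).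
  have [V V1 Vh] := ch (e / 2) (divr_gt0 e0 (ltr0Sn _ 1)).
  exists (U `&` V); first exact: filterI.
  move=> x y [/Uf fxy /Vh hxy].
  have -> : (a *: f + h) x - (a *: f + h) y = a * (f x - f y) + (h x - h y).
    by rewrite mulrBr opprD addrACA.
  apply: le_trans (ler_normD _ _) _; rewrite normrM.
  have -> : e%:C = b%:C * (e / 2 / b)%:C + (e / 2)%:C :> R[i].
    by rewrite -rmorphM -rmorphD /= mulrC divfK ?gt_eqF// -splitr.
  by apply: lerD => //; apply: ler_pM.
exists (complex.Re `|a| * M + N) => x.
apply: le_trans (ler_normD _ _) _; rewrite normrM rmorphD rmorphM /=.
apply: lerD => //; apply: ler_pM => //.
Qed.

HB.instance Definition _ :=
  GRing.isSubmodClosed.Build R[i] (G -> R[i]^o) rucb_pred rucb_submod_closed.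

Record RUCB : Type :=
  MkRUCB { rucb_fun :> G -> R[i]^o; _ : rucb_fun \in rucb_pred }.
HB.instance Definition _ := [isSub for rucb_fun].
HB.instance Definition _ := [Choice of RUCB by <:].
HB.instance Definition _ := [SubChoice_isSubLmodule of RUCB by <:].

Fact rucb1_proof : (fun=> 1 : R[i]^o) \in rucb_pred.
Proof.
apply/asboolP; split; last by exists 1 => x; rewrite normr1.
move=> e e0; exists setT; first exact: filterT.
by move=> x y _; rewrite subrr normr0 ler0c ltW.
Qed.

Definition rucb1 : RUCB := MkRUCB rucb1_proof.

Fact rucb_translate_proof (g : G) (f : RUCB) :
  (fun x => f (g * x)%g) \in rucb_pred.
Proof.
have /asboolP[cf [M Mf]] := valP f; apply/asboolP; split; last first.
  by exists M => x; exact: Mf.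
move=> e e0; have [U U1 Uf] := cf e e0.
exists [set z : G | U (g * z * g^-1)%g]; last first.
  by move=> x y /= Uxy; apply: Uf; rewrite invgM !mulgA in Uxy *.
have c : {for 1%g : G, continuous (fun z : G => (g * z * g^-1)%g)}.
  apply: (@continuous_comp _ _ _ (fun z : G => ((g * z)%g, (g^-1)%g))
     (fun p : G * G => (p.1 * p.2)%g)); last exact: mulg_continuous.
  apply: cvg_pair; last exact: cvg_cst.
  apply: (@continuous_comp _ _ _ (fun z : G => (g, z))
     (fun p : G * G => (p.1 * p.2)%g)); last exact: mulg_continuous.
  by apply: cvg_pair; [exact: cvg_cst|exact: cvg_id].
by apply: c; rewrite /= mulg1 mulgV.
Qed.

(* f \o lambda_g *)
Definition rucb_translate (g : G) (f : RUCB) : RUCB :=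
  MkRUCB (rucb_translate_proof g f).

(* The positive elements of the C*-algebra RUCB are the functions with values
   in the nonnegative reals; for z : R[i], 0 <= z says z is real and
   nonnegative. *)
Definition is_state (mu : {scalar RUCB}) :=
  (forall f : RUCB, (forall x, 0 <= f x :> R[i]) -> 0 <= mu f :> R[i]) /\
  mu rucb1 = 1.

Definition amenable :=
  exists2 mu : {scalar RUCB}, is_state mu &
    forall (f : RUCB) (g : G), mu (rucb_translate g f) = mu f.

End rucb.

Section measures.
Variables (R : realType) (G : topGroupType).

Definition borel : Type := g_sigma_algebraType (@open G).
HB.instance Definition _ :=
  Measurable.copy borel (g_sigma_algebraType (@open G)).

Variable mu : probability borel R.

Definition regular_measure :=
  forall B : set borel, measurable B ->
    mu B = ereal_sup [set mu K | K in [set K : set G | compact K /\ K `<=` B]].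

Definition spt : set G :=
  [set x | forall U : set G, open U -> U x -> (0 < mu U)%E].

Definition semigroup_closed (S : set G) := forall x y, S x -> S y -> S (x * y).

Definition non_degenerate := dense (smallest semigroup_closed spt).

End measures.

(* [Y] carries the discrete topology; the metric with all distances between
   distinct points equal to 1 induces it, and every bijection is isometric. *)
Record continuous_action (G : topGroupType) (Y : choiceType) :=
  ContinuousAction {
    act :> G -> Y -> Y;
    act1 : forall y, act 1 y = y;
    actM : forall g h y, act (g * h) y = act g (act h y);
    act_continuous : continuous (fun p : G * discrete_topology Y =>
      act p.1 p.2 : discrete_topology Y) }.

Section liouville.
Variables (R : realType) (G : topGroupType) (Y : choiceType).
Variable a : continuous_action G Y.
Local Open Scope ring_scope.

Definition mu_harmonic (mu : probability (borel G) R) (f : Y -> R) :=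
  forall y, f y = \int[mu]_g f (a g y).

Definition mu_liouville (mu : probability (borel G) R) :=
  forall f : Y -> R, (exists M : R, forall y, `|f y| <= M) ->
    mu_harmonic mu f -> exists c : R, f = cst c.

Definition liouville :=
  exists nu : probability (borel G) R,
    [/\ non_degenerate nu, regular_measure nu & mu_liouville nu].

End liouville.

Section orbit_action.
Variables (G : topGroupType) (Y : choiceType).

Lemma act_continuousP (a : G -> Y -> Y) :
  (forall g y, nbhs g [set h | a h y = a g y]) ->
  continuous (fun p : G * discrete_topology Y =>
    a p.1 p.2 : discrete_topology Y).
Proof.
move=> aP [g y]; apply/discrete_cvg.
exists ([set h | a h y = a g y], [set y : discrete_topology Y]).
  by split; [exact: aP|exact: discrete_set1].
by move=> [h z] [/= hE ->].
Qed.

Lemma act_nbhs (a : continuous_action G Y) g y :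
  nbhs g [set h | a h y = a g y].
Proof.
have := @act_continuous _ _ a (g, y) _
  (discrete_set1 (a g y : discrete_topology Y)).
move=> [[A B] [/= Ag By] AB].
by apply: filterS Ag => h Ah; exact: (AB (h, y) (conj Ah (nbhs_singleton By))).
Qed.

Variables (a : continuous_action G Y) (y : Y).

Record act_orbit : Type :=
  MkOrbit { orbit_val : Y; _ : `[< exists g : G, orbit_val = a g y >] }.
HB.instance Definition _ := [isSub for orbit_val].
HB.instance Definition _ := [Choice of act_orbit by <:].

Fact orbit_act_proof (g : G) (z : act_orbit) :
  `[< exists h : G, a g (val z) = a h y >].
Proof.
have /asboolP[h zE] := valP z.
by apply/asboolP; exists (g * h); rewrite actM -zE.
Qed.

Definition orbit_act (g : G) (z : act_orbit) : act_orbit :=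
  MkOrbit (orbit_act_proof g z).

Fact orbit_act1 z : orbit_act 1 z = z.
Proof. by apply: val_inj; exact: act1. Qed.

Fact orbit_actM g h z : orbit_act (g * h) z = orbit_act g (orbit_act h z).
Proof. by apply: val_inj; exact: actM. Qed.

End orbit_action.

Fact orbit_act_continuous (G : topGroupType) (Y : choiceType)
    (a : continuous_action G Y) (y : Y) :
  continuous (fun p : G * discrete_topology (act_orbit a y) =>
    orbit_act p.1 p.2 : discrete_topology (act_orbit a y)).
Proof.
apply: act_continuousP => g z.
by apply: filterS (act_nbhs a g (val z)) => h hE; exact: val_inj.
Qed.

Definition orbit_action (G : topGroupType) (Y : choiceType)
    (a : continuous_action G Y) (y : Y) : continuous_action G (act_orbit a y) :=
  ContinuousAction (@orbit_act1 G Y a y) (@orbit_actM G Y a y)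
    (@orbit_act_continuous G Y a y).

(* The finite subsets of X as a whole carry a continuous action of G; the
   action on {gB | g in G} is its restriction to the orbit of B. *)
Section fset_action.
Variables (X : choiceType) (G : groupClosed (Sym X)).
Local Open Scope fset_scope.

Definition perm_of (g : subgroup G) : X -> X := subgroup_val g.

Definition fset_act (g : subgroup G) (B : {fset X}) : {fset X} :=
  [fset perm_of g x | x in B].

Fact fset_act1 B : fset_act 1%g B = B.
Proof. by apply/fsetP => x; rewrite /fset_act imfset_id. Qed.

Fact fset_actM g h B : fset_act (g * h)%g B = fset_act g (fset_act h B).
Proof.
apply/fsetP => x; apply/imfsetP/imfsetP => /= -[y yB ->].
  by exists (perm_of h y) => //; exact: in_imfset.
by have /imfsetP[/= z zB ->] := yB; exists z.
Qed.

Fact fset_act_continuous :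
  continuous (fun p : subgroup G * discrete_topology {fset X} =>
    fset_act p.1 p.2 : discrete_topology {fset X}).
Proof.
apply: act_continuousP => g B.
have gB x : x \in B -> nbhs g [set h | perm_of h x = perm_of g x].
  move=> _.
  exact: (@subgroup_val_continuous _ G g) (sym_nbhs_eval (subgroup_val g) x).
have /(@filterS _ _ (nbhs_filter g)) := filter_bigI (nbhs_filter g) gB; apply => h hE.
by apply/fsetP => x; apply/imfsetP/imfsetP => /= -[y yB ->]; exists y => //;
   rewrite -(hE y yB : perm_of h y = perm_of g y).
Qed.

Definition fset_action : continuous_action (subgroup G) {fset X} :=
  ContinuousAction fset_act1 fset_actM fset_act_continuous.

End fset_action.

Definition preserves_linear_order (X : choiceType) (G : groupClosed (Sym X)) :=
  exists le : rel X, [/\ reflexive le, antisymmetric le, transitive le, total le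
    & forall g : subgroup G, {homo perm_of g : x y / le x y}].

(* Main.v *)
Require Import Defs.
From HB Require Import structures.
From mathcomp Require Import all_boot all_order all_algebra.
From mathcomp Require Import finmap complex.
From mathcomp Require Import all_classical all_reals all_analysis.
From mathcomp Require Import measurable_realfun.
From mathcomp Require Import ring lra.

Set Implicit Arguments.
Unset Strict Implicit.
Unset Printing Implicit Defensive.

Import Order.TTheory GRing.Theory Num.Theory.
Import numFieldNormedType.Exports.

Local Open Scope classical_set_scope.
Local Open Scope ring_scope.

(* (1) Let [a] be the action on an orbit [Y].  For [F] bounded on [Y] the map
   [x |-> F (x^-1 y)] is right-uniformly continuous, and left translation by [g]
   replaces [y] by [g^-1 y]; so an invariant mean cannot separate [y] from
   another point of [Y].  A minimax argument then yields finitely supported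
   probabilities on [G] that nearly equalize finitely many given points of [Y],
   uniformly over all functions bounded by 1.  As in Kaimanovich-Vershik, such
   probabilities [alpha_i] are chosen inductively, each one equalizing the points
   that short words in the supports of the previous ones can reach, and
   [nu = \sum_i 2^-(i+1) alpha_i] is Liouville; a little mass of [alpha_i] placed
   on the i-th term of a dense sequence makes it non-degenerate.

   (2) Let [P] be the Markov operator of a Liouville measure on an orbit [G B].
   Since [G B] is countable, ultralimits of the Cesaro means of [P^k F] commute
   with [P], so they are harmonic, hence constant: this gives a mean on the
   bounded functions on [G B] that does not depend on the starting point.  As [G]
   preserves a linear order, the setwise stabilizer of [B] is its pointwise
   stabilizer, so every right-uniformly continuous function on [G] is uniformly
   close to one of the form [x |-> F (x^-1 B)] for [B] large; an ultralimit over
   an exhaustion of [X] by finite sets [B] is an invariant mean. *)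

(** * Ultralimits of bounded sequences *)

Definition bounded_real (R : realType) T (f : T -> R) :=
  exists M : R, forall x, `|f x| <= M.

Lemma ultra_nat_ex : exists F : set_system nat, UltraFilter F /\ \oo `<=` F.
Proof. exact: ultraFilterLemma. Qed.

Definition ultra_nat : set_system nat := projT1 (cid ultra_nat_ex).

#[global] Instance ultra_nat_ultra : UltraFilter ultra_nat.
Proof. by rewrite /ultra_nat; case: cid => F []. Qed.

#[global] Instance ultra_nat_proper : ProperFilter ultra_nat.
Proof. by case: ultra_nat_ultra. Qed.

Lemma ultra_nat_oo : \oo `<=` ultra_nat.
Proof. by rewrite /ultra_nat; case: cid => F []. Qed.

Section ulim.
Variable R : realType.
Implicit Types u v : nat -> R.

Definition ulim u : R := lim (u @ ultra_nat).

(** By compactness of [[- M, M]] the image ultrafilter has a cluster point, and an ultrafilter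
    converges to each of its cluster points. *)
Lemma ulim_cvg u : bounded_real u -> u @ ultra_nat --> ulim u.
Proof.
move=> [M uM]; apply/cvg_ex.
have [p [_ clp]] : `[- M, M]%classic `&` cluster (u @ ultra_nat) !=set0.
  apply: (@segment_compact R (- M) M).
  change (ultra_nat (u @^-1` `[- M, M]%classic)).
  by apply: filterS filterT => n _; rewrite /= in_itv /= -ler_norml.
exists p => A /clp Ap.
have [//|nA] := in_ultra_setVsetC (u @^-1` A) ultra_nat_ultra.
by have [x [/= nAx Ax]] := Ap (~` A) nA.
Qed.

Lemma ulim_eq u l : u @ ultra_nat --> l -> ulim u = l.
Proof. exact: cvg_lim. Qed.

Lemma ulim_oo u l : u @ \oo --> l -> ulim u = l.
Proof.
move=> ul; apply: ulim_eq; apply: cvg_trans ul.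
by apply: cvg_app; exact: ultra_nat_oo.
Qed.

Lemma ulim_cst (c : R) : ulim (fun=> c) = c.
Proof. by apply: ulim_eq; exact: cvg_cst. Qed.

Lemma ulimD u v : bounded_real u -> bounded_real v ->
  ulim (fun n => u n + v n) = ulim u + ulim v.
Proof. by move=> /ulim_cvg cu /ulim_cvg cv; apply: ulim_eq; exact: cvgD. Qed.

Lemma ulimZ c u : bounded_real u -> ulim (fun n => c * u n) = c * ulim u.
Proof.
by move=> /ulim_cvg cu; apply: ulim_eq; apply: cvgM => //; exact: cvg_cst.
Qed.

Lemma ulimB u v : bounded_real u -> bounded_real v ->
  ulim (fun n => u n - v n) = ulim u - ulim v.
Proof. by move=> /ulim_cvg cu /ulim_cvg cv; apply: ulim_eq; exact: cvgB. Qed.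

Lemma ulim_ge u c : bounded_real u -> (\forall n \near \oo, c <= u n) ->
  c <= ulim u.
Proof.
move=> bu /ultra_nat_oo cu.
by apply: (@closed_cvg _ _ _ ultra_nat_proper u [set x | c <= x]) (ulim_cvg bu);
  [exact: closed_ge|exact: cu].
Qed.

Lemma ulim_le u c : bounded_real u -> (\forall n \near \oo, u n <= c) ->
  ulim u <= c.
Proof.
move=> bu /ultra_nat_oo cu.
by apply: (@closed_cvg _ _ _ ultra_nat_proper u [set x | x <= c]) (ulim_cvg bu);
  [exact: closed_le|exact: cu].
Qed.

Lemma ulim_norm_le u c : bounded_real u -> (\forall n \near \oo, `|u n| <= c) ->
  `|ulim u| <= c.
Proof.
move=> bu cu; rewrite ler_norml; apply/andP; split.
  by apply: ulim_ge => //; apply: filterS cu => n /=; rewrite ler_norml => /andP[].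
by apply: ulim_le => //; apply: filterS cu => n /=; rewrite ler_norml => /andP[].
Qed.

End ulim.

(** * A finite minimax theorem *)

(** One coordinate of a step in Blackwell's argument: the right-hand side is the square of
    [(1 - l) * d + l * (e - c)], with [d] the old deficit, left expanded so that the cross terms can
    be summed over the coordinates. *)
Lemma sqr_deficit_mix (R : realType) (l x c e : R) : 0 <= l -> l <= 1 ->
  Num.max 0 (e - ((1 - l) * x + l * c)) ^+ 2 <=
  (1 - l) ^+ 2 * Num.max 0 (e - x) ^+ 2 + l ^+ 2 * (c - e) ^+ 2
  - 2 * l * (1 - l) * (Num.max 0 (e - x) * c - e * Num.max 0 (e - x)).
Proof.
move=> l0 l1.
set d := Num.max 0 (e - x).
have d0 : 0 <= d by rewrite le_max lexx.
have dx : e - x <= d by rewrite le_max lexx orbT.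
have -> : (1 - l) ^+ 2 * d ^+ 2 + l ^+ 2 * (c - e) ^+ 2
    - 2 * l * (1 - l) * (d * c - e * d) = ((1 - l) * d + l * (e - c)) ^+ 2 by ring.
have [m0|m0] := leP (e - ((1 - l) * x + l * c)) 0.
  by rewrite expr0n /= sqr_ge0.
have le1 : e - ((1 - l) * x + l * c) <= (1 - l) * d + l * (e - c).
  have : (1 - l) * (e - x) <= (1 - l) * d by rewrite ler_wpM2l// subr_ge0.
  move=> h; apply: le_trans (lerD h (lexx (l * (e - c)))).
  by rewrite [leLHS](_ : _ = (1 - l) * (e - x) + l * (e - c))//; ring.
by apply: lerXn2r; rewrite ?nnegrE ?(ltW m0)//; exact: le_trans (ltW m0) le1.
Qed.

(* Blackwell's approachability argument: stepping from the current point, with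
   weight 1/(k+2), towards a point that is good for the weights given by the
   current deficits makes the sum of the squared deficits decay like 1/k. *)
Lemma approachability (R : realType) n (C : set ('I_n -> R)) (M e : R) :
  (forall c i, C c -> `|c i - e| <= M) ->
  (forall c c' l, C c -> C c' -> 0 <= l <= 1 ->
    C (fun i => (1 - l) * c i + l * c' i)) ->
  (forall w : 'I_n -> R, (forall i, 0 <= w i) ->
    exists2 c, C c & e * (\sum_i w i) <= \sum_i w i * c i) ->
  forall k, exists2 c, C c &
    (\sum_i Num.max 0 (e - c i) ^+ 2) * k.+1%:R <= n%:R * M ^+ 2.
Proof.
move=> CM Cmix Cw.
have sumM c : C c -> \sum_(i < n) (c i - e) ^+ 2 <= n%:R * M ^+ 2.
  move=> Cc; apply: (@le_trans _ _ (\sum_(i < n) M ^+ 2)); last first.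
    by rewrite sumr_const card_ord mulr_natl.
  apply: ler_sum => i _; rewrite -real_normK ?num_real//.
  by apply: lerXn2r; rewrite ?nnegrE// ?(le_trans _ (CM _ i Cc)) //; exact: CM.
elim=> [|k [x Cx IH]].
  (* Zero weights merely supply some point of [C]. *)
  have [|c Cc _] := Cw (fun=> 0) => //.
  exists c => //; rewrite mulr1; apply: le_trans (sumM c Cc).
  apply: ler_sum => i _; have [_|h] := leP (e - c i) 0.
    by rewrite expr0n /= sqr_ge0.
  by rewrite -(sqrrN (c i - e)) opprB.
pose d i := Num.max 0 (e - x i).
have d0 i : 0 <= d i by rewrite le_max lexx.
have [c Cc wc] := Cw d d0.
pose l : R := k.+2%:R^-1.
have l0 : 0 <= l by rewrite invr_ge0.
have l1 : l <= 1 by rewrite invf_le1// ler1n.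
exists (fun i => (1 - l) * x i + l * c i); first by apply: Cmix; rewrite ?l0.
set S := \sum_i d i ^+ 2 in IH.
have le1 : \sum_(i < n) Num.max 0 (e - ((1 - l) * x i + l * c i)) ^+ 2 <=
    (1 - l) ^+ 2 * S + l ^+ 2 * (n%:R * M ^+ 2).
  apply: (@le_trans _ _ (\sum_(i < n) ((1 - l) ^+ 2 * d i ^+ 2
     + l ^+ 2 * (c i - e) ^+ 2 - 2 * l * (1 - l) * (d i * c i - e * d i)))).
    by apply: ler_sum => i _; exact: sqr_deficit_mix.
  rewrite big_split /= big_split /= sumrN -!mulr_sumr -/S sumrB -mulr_sumr.
  apply: le_trans (lerD (lexx _) (ler_wpM2l (sqr_ge0 l) (sumM c Cc))).
  rewrite gerBl; apply: mulr_ge0; last by rewrite subr_ge0.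
  by rewrite !mulr_ge0// subr_ge0.
have lk : l * k.+2%:R = 1 by rewrite mulVf.
have lk' : (1 - l) * k.+2%:R = k.+1%:R.
  by rewrite mulrBl mul1r lk -natr1 addrK.
apply: le_trans (ler_wpM2r (ler0n _ _) le1) _.
set D := n%:R * M ^+ 2 in IH *.
(* The bound becomes a convex combination of [S * k.+1%:R] and [D], both at most [D]. *)
have -> : ((1 - l) ^+ 2 * S + l ^+ 2 * D) * k.+2%:R =
   (1 - l) * (S * ((1 - l) * k.+2%:R)) + (l * k.+2%:R) * (l * D) by ring.
rewrite lk lk' mul1r.
have : (1 - l) * (S * k.+1%:R) <= (1 - l) * D by rewrite ler_wpM2l// subr_ge0.
by move=> h; apply: le_trans (lerD h (lexx _)) _; rewrite -mulrDl subrK mul1r.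
Qed.

(** Once the sum of the squared deficits is below [h ^+ 2], each deficit is below [h]. As [C] need
    not be closed, the value [e] is approached only up to [h]. *)
Lemma minimax (R : realType) n (C : set ('I_n -> R)) (M e h : R) : 0 < h ->
  (forall c i, C c -> `|c i - e| <= M) ->
  (forall c c' l, C c -> C c' -> 0 <= l <= 1 ->
    C (fun i => (1 - l) * c i + l * c' i)) ->
  (forall w : 'I_n -> R, (forall i, 0 <= w i) ->
    exists2 c, C c & e * (\sum_i w i) <= \sum_i w i * c i) ->
  exists2 c, C c & forall i, e - h <= c i.
Proof.
move=> h0 CM Cmix Cw.
have [k hk] : exists k : nat, n%:R * M ^+ 2 <= h ^+ 2 * k.+1%:R.
  exists (Num.truncn (n%:R * M ^+ 2 / h ^+ 2)).
  by rewrite -ler_pdivrMl ?exprn_gt0// mulrC ltW// truncnS_gt.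
have [c Cc ck] := approachability CM Cmix Cw k.
exists c => // i; rewrite lerBlDr -lerBlDl.
have : Num.max 0 (e - c i) ^+ 2 <= h ^+ 2.
  have := le_trans ck hk; rewrite ler_pM2r ?ltr0Sn//; apply: le_trans.
  rewrite (bigD1 i)//= lerDl; apply: sumr_ge0 => j _; exact: sqr_ge0.
rewrite ler_sqr ?nnegrE ?le_max ?lexx ?(ltW h0)//.
by rewrite ge_max => /andP[].
Qed.

(** * Almost invariant probabilities *)

Section average.
Variables (R : realType) (T : Type).
Implicit Types (s : seq ({nonneg R} * T)) (f : T -> R).

Definition avg s f : R := \sum_(p <- s) p.1%:num * f p.2.

Definition is_distr s := avg s (fun=> 1) = 1.

Lemma avgB s f g : avg s f - avg s g = avg s (fun x => f x - g x).
Proof. by rewrite /avg -sumrB; apply: eq_bigr => p _; rewrite mulrBr. Qed.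

Lemma avgN s f : avg s (fun x => - f x) = - avg s f.
Proof. by rewrite /avg -sumrN; apply: eq_bigr => p _; rewrite mulrN. Qed.

Lemma avg_cst s c : is_distr s -> avg s (fun=> c) = c.
Proof.
move=> s1; rewrite -[RHS]mul1r -[X in X * _]s1 mulr_suml.
by apply: eq_bigr => p _; rewrite mulr1.
Qed.

End average.

(** * Duality between probabilities and test functions *)

Section separation.
Variables (R : realType) (G : topGroupType) (Y : choiceType).
Variable a : continuous_action G Y.
Implicit Types (F : Y * Y -> Y -> R) (ps : seq (Y * Y)).

(** One test function per pair: such families form a convex set on which the gap is linear, as the
    minimax theorem requires. *)
Definition gap ps F (g : G) : R :=
  \sum_(p <- ps) (F p (a g p.1) - F p (a g p.2)).

Definition unit_ball F := forall p y, `|F p y| <= 1.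

Lemma gap_bound ps F g : unit_ball F -> `|gap ps F g| <= \sum_(p <- ps) 2.
Proof.
move=> F1; apply: le_trans (ler_norm_sum _ _ _) _; apply: ler_sum => p _.
by apply: le_trans (ler_normB _ _) _; apply: lerD.
Qed.

Lemma gap_mix ps F F' l g :
  gap ps (fun p y => (1 - l) * F p y + l * F' p y) g =
  (1 - l) * gap ps F g + l * gap ps F' g.
Proof.
by rewrite /gap !mulr_sumr -big_split; apply: eq_bigr => p _ /=; ring.
Qed.

Lemma ulim_gap ps (F : nat -> Y * Y -> Y -> R) g :
  (forall n, unit_ball (F n)) ->
  gap ps (fun p y => ulim (fun n => F n p y)) g = ulim (fun n => gap ps (F n) g).
Proof.
move=> F1; rewrite /gap; elim: ps => [|p ps IH].
  rewrite big_nil -[LHS](@ulim_cst R); congr ulim.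
  by apply/funext => n; rewrite big_nil.
rewrite big_cons {}IH.
have bF q y : bounded_real (fun n => F n q y) by exists 1 => n; exact: F1.
rewrite -ulimB// -ulimD.
- by congr ulim; apply/funext => n; rewrite big_cons.
- by exists 2 => n; apply: le_trans (ler_normB _ _) _; apply: lerD; exact: F1.
- by exists (\sum_(p <- ps) 2) => n; exact: gap_bound.
Qed.

(* The bound is one-sided because [f] may be replaced by [- f]. *)
Definition almost_invariant (e : R) ps (s : seq ({nonneg R} * G)) :=
  forall f : Y -> R, (forall y, `|f y| <= 1) -> forall p, p \in ps ->
    avg s (fun g => f (a g p.1)) - avg s (fun g => f (a g p.2)) <= e.

(** Minimax for the game with moves [d i] against families [F]: normalized weights on the [d i] form
    a probability on [G], and its failure to be almost invariant provides a good answer [F]. The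
    slack [h] is [e / 2]. *)
Lemma finite_separation ps e n (d : 'I_n -> G) : uniq ps -> 0 < e ->
  (forall s, is_distr s -> ~ almost_invariant e ps s) ->
  exists2 F, unit_ball F & forall i, e / 2 <= gap ps F (d i).
Proof.
move=> ups e0 nai.
pose C : set ('I_n -> R) := [set c | exists2 F, unit_ball F &
  c = fun i => gap ps F (d i)].
have [| | | |c [F F1 ->] Fc] := @minimax R n C (\sum_(p <- ps) 2 + e) e (e / 2).
- by rewrite divr_gt0.
- move=> c i [F F1 ->]; apply: le_trans (ler_normB _ _) _.
  by rewrite (gtr0_norm e0) lerD2r; exact: gap_bound.
- move=> _ _ l [F F1 ->] [F' F'1 ->] /andP[l0 l1].
  exists (fun p y => (1 - l) * F p y + l * F' p y); last first.
    by apply/funext => i; rewrite gap_mix.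
  move=> p y; have l1' : 0 <= 1 - l by rewrite subr_ge0.
  apply: le_trans (ler_normD _ _) _; rewrite !normrM (ger0_norm l0) (ger0_norm l1').
  rewrite -[leRHS](subrK l) -[X in _ <= _ + X]mulr1 -[X in _ <= X + _]mulr1.
  by apply: lerD; apply: ler_wpM2l.
- move=> w w0; set W := \sum_i w i.
  have [W0|W0] := eqVneq W 0.
    exists (fun i => gap ps (fun _ _ => 0) (d i)).
      by exists (fun _ _ => 0) => // p y; rewrite normr0.
    rewrite W0 mulr0 big1// => i _.
    have := W0; move/eqP; rewrite psumr_eq0// => /allP /(_ i).
    by rewrite mem_index_enum => /(_ isT)/= /eqP ->; rewrite mul0r.
  have Wp : 0 < W by rewrite lt_neqAle eq_sym W0 sumr_ge0.
  have wW0 i : 0 <= w i / W by rewrite divr_ge0// ltW.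
  pose s : seq ({nonneg R} * G) := [seq (NngNum (wW0 i), d i) | i <- index_enum 'I_n].
  have avgE f : avg s f = W^-1 * \sum_i w i * f (d i).
    rewrite /avg big_map mulr_sumr; apply: eq_bigr => i _ /=.
    by rewrite mulrAC mulrC.
  have s1 : is_distr s.
    rewrite /is_distr avgE (eq_bigr w) ?mulVf// => i _; exact: mulr1.
  have := nai s s1; rewrite /almost_invariant.
  move=> /existsNP[f /not_implyP[f1 /existsNP[p0 /not_implyP[p0s /negP]]]].
  rewrite -ltNge avgB avgE mulrC ltr_pdivlMr// => fe.
  (* Only the failing pair [p0] is tested; as [ps] has no repetition, the gap reduces to this single
     term. *)
  pose F p y := if p == p0 then f y else 0.
  exists (fun i => gap ps F (d i)).
    exists F => // p y; rewrite /F; case: ifP => // _; by rewrite normr0.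
  apply: le_trans (ltW fe) _; rewrite le_eqVlt; apply/orP; left; apply/eqP.
  apply: eq_bigr => i _; congr (_ * _); rewrite /gap (bigD1_seq p0)//= big1.
    by rewrite addr0 /F eqxx.
  by move=> p /negPf pp; rewrite /F pp subrr.
exists F => // i; have := Fc i; lra.
Qed.

(** The ultralimit of families good for [d 0, ..., d (n - 1)] is good for every [d k]. The gap at
    [g] depends only on how [g] moves the finitely many points in [ps], so density covers all of
    [G]. *)
Lemma separation ps e (d : nat -> G) : uniq ps -> 0 < e ->
  (forall g (ys : seq Y), exists n, {in ys, forall y, a (d n) y = a g y}) ->
  (forall s, is_distr s -> ~ almost_invariant e ps s) ->
  exists2 F, unit_ball F & forall g, e / 2 <= gap ps F g.
Proof.
move=> ups e0 dd nai.
have /choice[F HF] : forall n, exists F, unit_ball F /\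
    forall i, (i < n)%N -> e / 2 <= gap ps F (d i).
  move=> n; have [F F1 Fn] := @finite_separation ps e n (fun i => d i) ups e0 nai.
  by exists F; split => // i ni; exact: Fn (Ordinal ni).
have F1 n := (HF n).1.
exists (fun p y => ulim (fun n => F n p y)).
  by move=> p y; apply: ulim_norm_le; [exists 1 => n; exact: F1|near=> n; exact: F1].
move=> g; have [k kE] := dd g ([seq p.1 | p <- ps] ++ [seq p.2 | p <- ps]).
have -> : gap ps (fun p y => ulim (fun n => F n p y)) g =
          gap ps (fun p y => ulim (fun n => F n p y)) (d k).
  rewrite /gap !big_seq; apply: eq_bigr => p pps.
  by rewrite -!kE// mem_cat map_f ?orbT.
rewrite ulim_gap//; apply: ulim_ge.
  by exists (\sum_(p <- ps) 2) => n; exact: gap_bound.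
by near=> n; apply: (HF n).2; near: n; exists k.+1.
Unshelve. all: by end_near. Qed.

End separation.

(** * Invariant means applied to orbit functions *)

Section orbit_functions.
Variables (R : realType) (G : topGroupType) (Y : choiceType).
Variable a : continuous_action G Y.
Local Open Scope complex_scope.
Implicit Types (f : Y -> R) (y : Y).

Lemma normcR (x : R) : `|x%:C| = `|x|%:C.
Proof. by rewrite normc_def /= expr0n addr0 sqrtr_sqr. Qed.

(** The stabilizer of [y] is a neighbourhood of 1, and if [x * z^-1] fixes [y] then [x^-1] and
    [z^-1] send [y] to the same point. *)
Lemma rucb_orbit_proof f y : bounded_real f ->
  (fun x => (f (a x^-1%g y))%:C : R[i]^o) \in @rucb_pred R G.
Proof.
move=> [M fM]; apply/asboolP; split; last first.
  by exists M => x; rewrite normcR lecR.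
move=> e e0; exists [set u | a u y = a 1%g y]; first exact: act_nbhs.
move=> x z; rewrite /= act1 => xz.
rewrite (_ : a x^-1%g y = a z^-1%g y) ?subrr ?normr0 ?ler0c ?ltW//.
by rewrite -[in LHS]xz -actM mulgA mulVg mul1g.
Qed.

Definition rucb_orbit f (bf : bounded_real f) y : RUCB R G :=
  MkRUCB (rucb_orbit_proof y bf).

Lemma rucb_translate_orbit f (bf : bounded_real f) g y :
  rucb_translate g (rucb_orbit bf y) = rucb_orbit bf (a g^-1%g y).
Proof.
apply: val_inj; apply/funext => x /=.
by rewrite invgM actM.
Qed.

(** By transitivity and invariance the two orbit functions of a pair have the same mean. The gap
    thus has mean 0, and positivity forces its lower bound [e] below 0. *)
Lemma amenable_gap ps (F : Y * Y -> Y -> R) e : amenable R G ->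
  (forall y z, exists g, z = a g y) ->
  unit_ball F -> (forall g, e <= gap a ps F g) -> e <= 0.
Proof.
move=> [mu [mu_ge0 mu1] mu_inv] tr F1 Fe.
have bF p : bounded_real (F p) by exists 1; exact: F1.
pose D p : RUCB R G := rucb_orbit (bF p) p.1 - rucb_orbit (bF p) p.2.
have muD p : mu (D p) = 0.
  have [g gE] := tr p.2 p.1.
  rewrite /D linearB gE -[g in a g _]invgK -rucb_translate_orbit mu_inv.
  by rewrite subrr.
pose H : RUCB R G := \sum_(p <- ps) D p - e%:C *: rucb1 R G.
have H_ge0 x : 0 <= H x :> R[i].
  have -> : H x = (gap a ps F x^-1%g - e)%:C :> R[i].
    rewrite rmorphB /=; congr (_ - _); last exact: mulr1.
    rewrite /gap rmorph_sum /=; elim: (ps) => [|p s IH].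
      by rewrite !big_nil.
    rewrite !big_cons -IH; congr (_ + _).
    by rewrite rmorphB.
  by rewrite ler0c subr_ge0.
have := mu_ge0 H H_ge0; rewrite /H linearB linearZ /= mu1 linear_sum big1//.
by rewrite sub0r oppr_ge0 /= mulr1 lecR.
Qed.

Lemma almost_invariant_distr ps e (d : nat -> G) : amenable R G ->
  (forall y z, exists g, z = a g y) ->
  (forall g (ys : seq Y), exists n, {in ys, forall y, a (d n) y = a g y}) ->
  0 < e ->
  exists2 s : seq ({nonneg R} * G), is_distr s & almost_invariant a e ps s.
Proof.
move=> amG tr dd e0; apply: contrapT => /forall2NP nai.
have [|F F1 Fe] := @separation R G Y a (undup ps) e d (undup_uniq _) e0 dd.
  move=> s s1 ai; have [//|] := nai s; apply => f f1 p pps; apply: ai => //.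
  by rewrite mem_undup.
have := amenable_gap amG tr F1 Fe; lra.
Qed.

Lemma almost_invariant_charging ps e (d : nat -> G) g : amenable R G ->
  (forall y z, exists g, z = a g y) ->
  (forall g (ys : seq Y), exists n, {in ys, forall y, a (d n) y = a g y}) ->
  0 < e ->
  exists s : seq ({nonneg R} * G), [/\ is_distr s, almost_invariant a e ps s &
    exists2 p, p \in s & 0 < p.1%:num /\ p.2 = g].
Proof.
move=> amG tr dd e0.
have e2 : 0 < e / 2 by rewrite divr_gt0.
have [s s1 ai] := almost_invariant_distr ps amG tr dd e2.
(* The mass [t] at [g] changes a difference by at most [2 * t <= e / 2], the other half of the
   error; the bound [1 / 2] keeps [1 - t] nonnegative. *)
pose t : R := Num.min (1 / 2) (e / 4).
have t0 : 0 < t by rewrite lt_min !divr_gt0.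
have t1 : 0 <= 1 - t by rewrite subr_ge0 ge_min; apply/orP; left; lra.
have te : t <= e / 4 by rewrite ge_min lexx orbT.
have t1s (p : {nonneg R} * G) : 0 <= (1 - t) * p.1%:num by rewrite mulr_ge0.
pose s' : seq ({nonneg R} * G) := (NngNum (ltW t0), g) ::
  [seq (NngNum (t1s p), p.2) | p <- s].
have avgE (f : G -> R) : avg s' f = t * f g + (1 - t) * avg s f.
  rewrite /avg big_cons big_map mulr_sumr; congr (_ + _).
  by apply: eq_bigr => p _; rewrite /= mulrA.
exists s'; split.
- by rewrite /is_distr avgE s1 !mulr1 addrC subrK.
- move=> f f1 p pps; rewrite !avgE.
  have := ai f f1 p pps; rewrite -subr_ge0 => h1.
  have h2 : f (a g p.1) - f (a g p.2) <= 2.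
    apply: le_trans (ler_norm _) _; apply: le_trans (ler_normB _ _) _.
    by apply: lerD.
  set A := avg _ _ in h1 *; set B := avg _ _ in h1 *.
  have h3 : (1 - t) * (A - B) <= e / 2.
    have [h|h] := leP (A - B) 0.
      by apply: (@le_trans _ _ 0); [rewrite mulr_ge0_le0|lra].
    apply: (@le_trans _ _ (A - B)); last by rewrite -subr_ge0.
    by rewrite ler_piMl ?(ltW h)// lerBlDr lerDl ltW.
  have h4 : t * (f (a g p.1) - f (a g p.2)) <= e / 4 * 2.
    apply: (@le_trans _ _ (t * 2)); first by rewrite ler_wpM2l// ltW.
    by rewrite ler_wpM2r.
  lra.
- by exists (NngNum (ltW t0), g); rewrite ?mem_head.
Qed.

End orbit_functions.

(** * Mixtures of finitely supported probabilities *)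

Section bounded_integrable.
Context d (T : measurableType d) (R : realType) (mu : probability T R).

Lemma bounded_integrable (f : T -> R) : measurable_fun setT f ->
  bounded_real f -> mu.-integrable setT (EFin \o f).
Proof.
move=> mf [M fM]; apply: measurable_bounded_integrable => //.
  by rewrite (le_lt_trans (probability_le1 _ _))// ltry.
exists M; split; first exact: num_real.
by move=> x Mx y _; rewrite /= (le_trans (fM y))// ltW.
Qed.

Lemma Rintegral_cst_prob (c : R) : \int[mu]_x c = c.
Proof.
rewrite Rintegral_cst// (_ : fine _ = 1) ?mulr1//.
exact: (congr1 fine (@probability_setT _ _ _ mu)).
Qed.

End bounded_integrable.

Section mixture_sum.
Variables (R : realType) (T : Type).
Implicit Types (f : T -> R).

Definition half_weight i : {nonneg R} := ((2 ^ i.+1)%:R^-1)%:nng.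

Lemma sum_half_weight n :
  \sum_(i < n) (half_weight i)%:num = 1 - (2 ^ n)%:R^-1 :> R.
Proof.
elim: n => [|n IH]; first by rewrite big_ord0 expn0 invr1 subrr.
rewrite big_ord_recr /= IH.
have h : (2 ^ n)%:R^-1 = 2 * (2 ^ n.+1)%:R^-1 :> R.
  by rewrite expnS natrM invfM mulrA mulfV// mul1r.
rewrite h; ring.
Qed.

Variable s_ : nat -> seq ({nonneg R} * T).

Definition mixture_sum n f : R :=
  \sum_(i < n) (half_weight i)%:num * avg (s_ i) f.

Lemma mixture_term_ge0 f i : (forall x, 0 <= f x) ->
  0 <= (half_weight i)%:num * avg (s_ i) f.
Proof. by move=> f0; rewrite mulr_ge0// sumr_ge0// => p _; rewrite mulr_ge0. Qed.

Lemma mixture_sum_cst n c : (forall i, is_distr (s_ i)) ->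
  mixture_sum n (fun=> c) = (1 - (2 ^ n)%:R^-1) * c.
Proof.
move=> s_distr.
rewrite /mixture_sum -sum_half_weight mulr_suml; apply: eq_bigr => i _.
by rewrite avg_cst.
Qed.

End mixture_sum.
Arguments half_weight {R}.

Section mixture.
Context d (T : measurableType d) (R : realType).
Implicit Types (s : seq ({nonneg R} * T)) (f : T -> R).

Definition distr_measure s : set T -> \bar R :=
  msum (fun k => [the measure T R of
    mscale (nth (0%:nng, point) s k).1 (\d_(nth (0%:nng, point) s k).2)]) (size s).

HB.instance Definition _ s := Measure.on (distr_measure s).

Lemma distr_measureE s A : distr_measure s A = (avg s \1_A)%:E.
Proof.
rewrite /distr_measure /msum /= /avg (big_nth (0%:nng, point)) big_mkord -sumEFin.
by apply: eq_bigr => k _; rewrite /mscale /= EFinM.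
Qed.

Lemma ge0_integral_distr s f : measurable_fun setT f -> (forall x, 0 <= f x) ->
  (\int[distr_measure s]_x (f x)%:E = (avg s f)%:E)%E.
Proof.
move=> mf f0.
have /measurable_EFinP mf' := mf.
rewrite ge0_integral_measure_sum//; last by move=> x _; rewrite lee_fin.
rewrite /avg (big_nth (0%:nng, point)) big_mkord -sumEFin.
apply: eq_bigr => k _; rewrite ge0_integral_mscale//; last first.
  by move=> x _; rewrite lee_fin.
by rewrite integral_dirac//= diracT mul1e EFinM.
Qed.

Variable s_ : nat -> seq ({nonneg R} * T).

Definition mixture : set T -> \bar R :=
  mseries (fun i => [the measure T R of mscale (half_weight i)
    [the measure T R of distr_measure (s_ i)]]) 0.

HB.instance Definition _ := Measure.on mixture.

Lemma mixtureE A : mixture A =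
  (\sum_(i <oo) ((half_weight i)%:num * avg (s_ i) \1_A)%:E)%E.
Proof.
rewrite /mixture /mseries; apply: eq_eseriesr => i _.
by rewrite EFinM -distr_measureE.
Qed.

Lemma mixture_sum_cvge f : (forall x, 0 <= f x) ->
  (mixture_sum s_ n f)%:E @[n --> \oo] -->
    (\sum_(i <oo) ((half_weight i)%:num * avg (s_ i) f)%:E)%E.
Proof.
move=> f0.
rewrite (_ : (fun n => (mixture_sum s_ n f)%:E) = (fun n =>
    (\sum_(0 <= i < n) ((half_weight i)%:num * avg (s_ i) f)%:E)%E)); last first.
  by apply/funext => n; rewrite big_mkord sumEFin.
by apply: is_cvg_nneseries => i _ _; rewrite lee_fin mixture_term_ge0.
Qed.

Hypothesis s_distr : forall i, is_distr (s_ i).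

Lemma mixture_setT : mixture setT = 1%E.
Proof.
rewrite mixtureE -(cvg_lim _ (mixture_sum_cvge _))//; apply: cvg_lim => //.
apply: cvg_EFin; first by near=> n.
rewrite (_ : _ \o _ = fun n => 1 - (2^-1) ^+ n : R); last first.
  apply/funext => n /=; rewrite indicT mixture_sum_cst// mulr1 natrX exprVn//.
rewrite -[X in _ --> X]subr0; apply: cvgB; first exact: cvg_cst.
apply: cvg_expr; rewrite ger0_norm ?invr_ge0// invf_lt1// ltr1n.
Unshelve. all: by end_near. Qed.

HB.instance Definition _ := @Measure_isProbability.Build _ _ _ mixture mixture_setT.

Definition mixture_prob : probability T R := mixture.

Lemma ge0_integral_mixture_cvg f M : measurable_fun setT f ->
  (forall x, 0 <= f x <= M) ->
  mixture_sum s_ n f @[n --> \oo] --> \int[mixture_prob]_x f x.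
Proof.
move=> mf f0M.
have f0 x : 0 <= f x by case/andP: (f0M x).
have /measurable_EFinP mf' := mf.
have := mixture_sum_cvge f0.
rewrite (_ : (\sum_(i <oo) _)%E = (\int[mixture]_x (f x)%:E)%E); last first.
  rewrite ge0_integral_measure_series//; last by move=> x _; rewrite lee_fin.
  apply: eq_eseriesr => i _; rewrite ge0_integral_mscale//; last first.
    by move=> x _; rewrite lee_fin.
  by rewrite ge0_integral_distr// EFinM.
have /(integrable_fin_num measurableT) fin : mixture_prob.-integrable setT (EFin \o f).
  apply: bounded_integrable => //; exists M => x.
  by rewrite ger0_norm// (andP (f0M x)).2.
by rewrite -(fineK fin) => /fine_cvg.
Qed.

(** Adding the bound [M] reduces to nonnegative functions, for which integration against a series of
    measures is termwise. *)
Lemma integral_mixture_cvg f : measurable_fun setT f -> bounded_real f ->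
  mixture_sum s_ n f @[n --> \oo] --> \int[mixture_prob]_x f x.
Proof.
move=> mf [M fM].
have M0 : 0 <= M by rewrite (le_trans _ (fM point)).
have cM : mixture_sum s_ n (fun=> M) @[n --> \oo] --> M.
  have := @ge0_integral_mixture_cvg (fun=> M) M (measurable_cst _).
  by rewrite Rintegral_cst_prob; apply => x; rewrite M0 lexx.
have fM0 x : 0 <= f x + M <= M + M.
  by have := fM x; rewrite ler_norml => /andP[h1 h2]; rewrite -lerBlDr sub0r h1 lerD2r.
have mfM : measurable_fun [set: T] (fun x => f x + M) by exact: measurable_funD.
have intf : mixture_prob.-integrable setT (EFin \o f).
  by apply: bounded_integrable => //; exists M.
have intM : mixture_prob.-integrable setT (EFin \o (fun=> M)).
  by apply: bounded_integrable => //; exists `|M|.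
have intE : \int[mixture_prob]_x (f x + M) = \int[mixture_prob]_x f x + M.
  by rewrite RintegralD// Rintegral_cst_prob.
have -> : mixture_sum s_ ^~ f =
    fun n => mixture_sum s_ n (fun x => f x + M) - mixture_sum s_ n (fun=> M).
  apply/funext => n; rewrite /mixture_sum -sumrB; apply: eq_bigr => i _.
  by rewrite -mulrBr avgB; congr (_ * avg _ _); apply/funext => x; rewrite addrK.
rewrite -[X in _ --> X](addrK M) -intE.
exact: cvgB (ge0_integral_mixture_cvg mfM fM0) cM.
Qed.

End mixture.


Section mixture_topology.
Variables (R : realType) (G : topGroupType).
Variable s_ : nat -> seq ({nonneg R} * borel G).
Hypothesis s_distr : forall i, is_distr (s_ i).
Local Notation nu := (mixture_prob s_distr).

(** Read off the explicit series, so that it holds for arbitrary sets: when [G] is not Hausdorff, a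
    compact set may fail to be Borel. *)
Lemma le_mixture (A B : set G) : A `<=` B -> (mixture s_ A <= mixture s_ B)%E.
Proof.
move=> AB; rewrite !mixtureE; apply: lee_nneseries => i _.
  by rewrite lee_fin mixture_term_ge0.
rewrite lee_fin ler_wpM2l//; apply: ler_sum => p _; rewrite ler_wpM2l//.
by rewrite !indicE ler_nat; case: (boolP (_ \in A)) => // /set_mem/AB/mem_set ->.
Qed.

(** Each partial sum of the series lives on finitely many points, and those lying in [B] form a
    compact set. *)
Lemma mixture_regular : regular_measure nu.
Proof.
move=> B _; apply/eqP; rewrite eq_le; apply/andP; split; last first.
  by apply: ge_ereal_sup => _ [K [_ KB] <-]; exact: le_mixture.
rewrite /= mixtureE; apply: lime_le.
  by apply: is_cvg_nneseries => i _ _; rewrite lee_fin mixture_term_ge0.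
near=> n.
pose K : set G := B `&` [set` [seq p.2 | p <- flatten [seq s_ i | i <- iota 0 n]]].
apply: (@le_trans _ _ (mixture s_ K)); last first.
  apply: ereal_sup_ubound; exists K => //; split; last exact: subIsetl.
  by apply: finite_compact; apply: sub_finite_set (finite_seq _); exact: subIsetr.
rewrite mixtureE; apply: le_trans (nneseries_lim_ge n _); last first.
  by move=> i _; rewrite lee_fin mixture_term_ge0.
rewrite !big_mkord; apply: lee_sum => i _; rewrite lee_fin ler_wpM2l//.
rewrite le_eqVlt; apply/orP; left; apply/eqP.
rewrite /avg !big_seq; apply: eq_bigr => p ps; congr (_ * _).
rewrite !indicE; congr ((_ : bool)%:R); apply/idP/idP; last first.
  by move=> /set_mem[Bp _]; exact/mem_set.
move=> /set_mem Bp; apply/mem_set; split => //=.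
apply/mapP; exists p => //; apply/flattenP; exists (s_ i) => //.
by apply/mapP; exists (val i); rewrite ?mem_iota /=.
Unshelve. all: by end_near. Qed.

Lemma mixture_spt i p : p \in s_ i -> 0 < p.1%:num -> spt nu p.2.
Proof.
move=> pi p0 U _ Up; rewrite /= mixtureE.
apply: lt_le_trans (nneseries_lim_ge i.+1 _); last first.
  by move=> j _; rewrite lee_fin mixture_term_ge0.
rewrite big_mkord big_ord_recr /=.
apply: lt_le_trans (leeDr _ _); last first.
  by apply: sume_ge0 => j _; rewrite lee_fin mixture_term_ge0.
rewrite lte_fin mulr_gt0 ?invr_gt0 ?ltr0n ?expn_gt0//.
rewrite /avg (big_rem p)//=; apply: ltr_pwDl.
  by rewrite indicE mem_set// mulr1.
by apply: sumr_ge0 => q _; rewrite mulr_ge0.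
Qed.

End mixture_topology.

(** * Amenable groups have Liouville actions *)

(** Bernoulli's inequality as an upper bound on [(1 - x) ^+ n]; the induction rests on
    [(1 - x) * (1 + (n + 1) * x) <= 1 + n * x]. *)
Lemma bernoulli_le (R : realFieldType) (x : R) n : 0 <= x <= 1 ->
  (1 - x) ^+ n * (1 + n%:R * x) <= 1.
Proof.
move=> /andP[x0 x1]; elim: n => [|n IH]; first by rewrite expr0 mul0r addr0 mulr1.
apply: le_trans IH; rewrite exprSr -mulrA ler_wpM2l ?exprn_ge0 ?subr_ge0//.
rewrite -natr1 -subr_ge0.
have -> : 1 + n%:R * x - (1 - x) * (1 + (n%:R + 1) * x) = (n%:R + 1) * x ^+ 2 by ring.
by rewrite mulr_ge0 ?sqr_ge0// natr1.
Qed.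

Lemma avg_norm_le (R : realType) (T : eqType) (s : seq ({nonneg R} * T))
    (f : T -> R) c :
  is_distr s -> (forall p, p \in s -> `|f p.2| <= c) -> `|avg s f| <= c.
Proof.
move=> s1 fc; rewrite -[leRHS](avg_cst c s1); apply: le_trans (ler_norm_sum _ _ _) _.
rewrite /avg !big_seq; apply: ler_sum => p ps.
by rewrite normrM ger0_norm// ler_wpM2l// fc.
Qed.

(** * Balls in the orbit and the inductive choice of the stages *)

Section reach.
Variables (G : topGroupType) (Y : choiceType) (a : continuous_action G Y).
Implicit Types (S : seq G) (E : seq Y).

Definition reach S E n := iter n (fun E' => E' ++ [seq a g y | g <- S, y <- E']) E.

Lemma reachS S E n y : y \in reach S E n -> y \in reach S E n.+1.
Proof. by move=> yn; rewrite /= mem_cat yn. Qed.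

Lemma reach_step S E n g y : g \in S -> y \in reach S E n ->
  a g y \in reach S E n.+1.
Proof. by move=> gS yn; rewrite /= mem_cat allpairs_f ?orbT. Qed.

Lemma reach_mono S S' E E' n n' : {subset S <= S'} -> {subset E <= E'} ->
  (n <= n')%N -> {subset reach S E n <= reach S' E' n'}.
Proof.
move=> SS EE nn y yn.
have {}yn : y \in reach S' E' n.
  elim: n {nn} y yn => [|n IH] y; first exact: EE.
  rewrite /= mem_cat => /orP[/IH/reachS//|/allpairsP[[g z] /= [gS zn ->]]].
  by apply: reach_step; [exact: SS|exact: IH].
rewrite -(subnK nn) addnC; elim: (n' - n)%N => [|k IH]; first by rewrite addn0.
by rewrite addnS; exact: reachS.
Qed.

End reach.

Section construction.
Variables (R : realType) (G : topGroupType) (Y : choiceType).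
Variables (a : continuous_action G Y) (y0 : Y) (d : nat -> G).
Variable pick : seq (Y * Y) -> nat -> seq ({nonneg R} * G).

(* Words of length [i * 2 ^ i] suffice: the first [i] terms of the mixture have
   total weight [q = 1 - 2^-i], and Bernoulli's inequality gives
   [q ^+ (i * 2 ^ i) <= 1 / (i + 1)]. *)
Definition ball_at i S :=
  reach a S [seq a (d k) y0 | k <- iota 0 i.+1] (i * 2 ^ i).

Definition pairs (E : seq Y) := [seq (y, z) | y <- E, z <- E].

(** The supports of the stages before [i]. The recursion runs through this list because a stage
    depends on the earlier ones only through it. *)
Fixpoint letters i :=
  if i is j.+1 then
    letters j ++ [seq p.2 | p <- pick (pairs (ball_at j (letters j))) j]
  else [::].

Definition stage i := pick (pairs (ball_at i (letters i))) i.

Lemma letters_mono i j : (i <= j)%N -> {subset letters i <= letters j}.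
Proof.
move=> /subnK <-; rewrite addnC; elim: (j - i)%N => [|k IH] g gi.
  by rewrite addn0.
by rewrite addnS /= mem_cat IH.
Qed.

Lemma stage_letters i j p : (i < j)%N -> p \in stage i -> p.2 \in letters j.
Proof.
by move=> /letters_mono ij pi; apply: ij; rewrite /= mem_cat map_f ?orbT.
Qed.

Lemma ball_mono i j : (i <= j)%N ->
  {subset ball_at i (letters i) <= ball_at j (letters j)}.
Proof.
move=> ij; apply: reach_mono; first exact: letters_mono.
  move=> y /mapP[k]; rewrite mem_iota add0n => ki ->.
  by apply: (map_f (fun k => a (d k) y0)); rewrite mem_iota add0n (leq_trans ki).
by rewrite leq_mul// leq_pexp2l.
Qed.

Hypothesis pick_distr : forall ps i, is_distr (pick ps i).
Hypothesis pick_inv : forall ps i,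
  almost_invariant a i.+1%:R^-1 ps (pick ps i).

Lemma stage_distr i : is_distr (stage i). Proof. exact: pick_distr. Qed.

Lemma stage_inv (f : Y -> R) i z z' : (forall y, `|f y| <= 1) ->
  z \in ball_at i (letters i) -> z' \in ball_at i (letters i) ->
  `|avg (stage i) (fun g => f (a g z) - f (a g z'))| <= i.+1%:R^-1.
Proof.
move=> f1 zi zi'; rewrite ler_norml lerNl -avgN; apply/andP; split.
  rewrite (_ : (fun x => _) = (fun g => f (a g z') - f (a g z))); last first.
    by apply/funext => g; rewrite opprB.
  rewrite -(avgB (stage i) (fun g => f (a g z')) (fun g => f (a g z))).
  by have := @pick_inv _ i f f1 (z', z); apply; apply: allpairs_f.
rewrite -(avgB (stage i) (fun g => f (a g z)) (fun g => f (a g z'))).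
by have := @pick_inv _ i f f1 (z, z'); apply; apply: allpairs_f.
Qed.

Lemma mixture_sum_split m n (f : G -> R) : (m <= n)%N ->
  mixture_sum stage n f = mixture_sum stage m f +
    \sum_(m <= i < n) (half_weight i)%:num * avg (stage i) f.
Proof.
by move=> mn; rewrite /mixture_sum -!(big_mkord xpredT
  (fun i => (half_weight i)%:num * avg (stage i) f)) (big_cat_nat (leq0n m) mn).
Qed.

(* Unfold [f z - f z'] as an average of [f (g z) - f (g z')].  The [g] chosen by a
   stage [i >= m] contribute at most [1 / (m + 1)], since [z] and [z'] lie in the
   ball that stage [i] equalizes; for the others, of total weight [1 - 2^-m], apply
   the induction hypothesis to [g z] and [g z']. *)
Lemma harmonic_oscillation (f : Y -> R) m n j z z' :
  (forall y, `|f y| <= 1) ->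
  (forall y, mixture_sum stage k (fun g => f (a g y)) @[k --> \oo] --> f y) ->
  let E := [seq a (d k) y0 | k <- iota 0 m.+1] in
  (j + n <= m * 2 ^ m)%N ->
  z \in reach a (letters m) E j -> z' \in reach a (letters m) E j ->
  `|f z - f z'| <= 2 * (1 - (2 ^ m)%:R^-1) ^+ n + m.+1%:R^-1.
Proof.
move=> f1 harm E; elim: n j z z' => [|n IH] j z z' jn zj zj'.
  rewrite expr0 mulr1; apply: le_trans (ler_normB _ _) _.
  by rewrite (le_trans (lerD (f1 _) (f1 _)))// lerDl invr_ge0.
set q : R := 1 - _; set e : R := _^-1.
have q0 : 0 <= q by rewrite subr_ge0 invf_le1 ?ler1n ?ltr0n ?expn_gt0.
have jm : (j <= m * 2 ^ m)%N by rewrite (leq_trans _ jn)// leq_addr.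
pose phi g := f (a g z) - f (a g z').
have cphi : `|mixture_sum stage k phi| @[k --> \oo] --> `|f z - f z'|.
  apply: cvg_norm; rewrite (_ : mixture_sum stage^~ phi = fun k =>
      mixture_sum stage k (fun g => f (a g z)) -
      mixture_sum stage k (fun g => f (a g z'))).
    by apply: cvgB; exact: harm.
  apply/funext => k; rewrite /mixture_sum -sumrB.
  by apply: eq_bigr => i _; rewrite -mulrBr avgB.
apply: (closed_cvg (fun x => x <= 2 * q ^+ n.+1 + e) _ _ _ cphi).
  exact: closed_le.
near=> k.
have mk : (m <= k)%N by near: k; exists m.
rewrite (mixture_sum_split _ mk); apply: le_trans (ler_normD _ _) _.
have -> : 2 * q ^+ n.+1 + e = q * (2 * q ^+ n + e) + (1 - q) * e.
  by rewrite exprS; ring.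
apply: lerD.
  apply: (@le_trans _ _ ((\sum_(i < m) (half_weight i)%:num) * (2 * q ^+ n + e))).
    rewrite mulr_suml; apply: le_trans (ler_norm_sum _ _ _) _.
    apply: ler_sum => i _; rewrite normrM ger0_norm// ler_wpM2l//.
    apply: avg_norm_le; first exact: stage_distr.
    move=> p pi; have := IH j.+1 (a p.2 z) (a p.2 z'); apply.
    - by rewrite addSn -addnS.
    - by apply: reach_step zj; exact: stage_letters pi.
    - by apply: reach_step zj'; exact: stage_letters pi.
  by rewrite sum_half_weight.
have hk : \sum_(m <= i < k) (half_weight i)%:num <= 1 - q.
  rewrite -(lerD2l q) [leRHS]addrC subrK {1}/q -(sum_half_weight R m).
  rewrite -(big_mkord xpredT (fun i => (half_weight i)%:num)).
  rewrite -(big_cat_nat (leq0n m) mk)/=.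
  by rewrite big_mkord sum_half_weight gerBl invr_ge0.
apply: le_trans (ler_norm_sum _ _ _) _.
apply: (@le_trans _ _ (\sum_(m <= i < k) (half_weight i)%:num * e)).
  rewrite big_nat_cond [leRHS]big_nat_cond; apply: ler_sum => i.
  rewrite andbT => /andP[mi _].
  rewrite normrM ger0_norm// ler_wpM2l//.
  apply: le_trans (stage_inv f1 _ _) _.
  - by apply: ball_mono mi _ _; exact: reach_mono zj.
  - by apply: ball_mono mi _ _; exact: reach_mono zj'.
  - by rewrite lef_pV2 ?posrE ?ltr0n// ler_nat.
by rewrite -mulr_suml ler_wpM2r// invr_ge0.
Unshelve. all: by end_near. Qed.

(** For [m >= k, l] both points lie in the centre of the ball of stage [m], so all [m * 2 ^ m] steps
    are available and the oscillation bound is at most [3 / (m + 1)]. *)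
Lemma harmonic_const (f : Y -> R) k l :
  (forall y, `|f y| <= 1) ->
  (forall y, mixture_sum stage k (fun g => f (a g y)) @[k --> \oo] --> f y) ->
  f (a (d k) y0) = f (a (d l) y0).
Proof.
move=> f1 harm; apply/eqP; rewrite -subr_eq0 -normr_le0.
have c3 : 3 * (m.+1%:R^-1 : R) @[m --> \oo] --> 0.
  rewrite -[X in _ --> X](mulr0 3); apply: cvgM; first exact: cvg_cst.
  exact: cvg_harmonic.
apply: (closed_cvg (fun x => `|f (a (d k) y0) - f (a (d l) y0)| <= x) _ _ _ c3).
  exact: closed_ge.
near=> m.
have km : (k <= m)%N by near: m; exists k.
have lm : (l <= m)%N by near: m; exists l.
apply: le_trans (@harmonic_oscillation f m (m * 2 ^ m) 0 _ _ f1 harm _ _ _) _ => //.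
- by apply: (map_f (fun k => a (d k) y0)); rewrite mem_iota.
- by apply: (map_f (fun k => a (d k) y0)); rewrite mem_iota.
rewrite [leRHS](_ : _ = 2 * m.+1%:R^-1 + m.+1%:R^-1); last ring.
rewrite lerD2r ler_wpM2l// -[leRHS]mul1r ler_pdivlMr ?ltr0n//.
have := @bernoulli_le R (2 ^ m)%:R^-1 (m * 2 ^ m).
rewrite natrM mulfK ?gt_eqF ?ltr0n ?expn_gt0// (addrC 1 m%:R) natr1; apply.
by rewrite invr_ge0 ler0n invf_le1 ?ler1n ?ltr0n ?expn_gt0.
Unshelve. all: by end_near. Qed.

End construction.

(** The orbit map is locally constant, so preimages under it are open. *)
Lemma orbit_map_measurable (R : realType) (G : topGroupType) (Y : choiceType)
    (a : continuous_action G Y) (f : Y -> R) y :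
  measurable_fun setT (fun g : borel G => f (a g y)).
Proof.
move=> _ B mB; rewrite setTI; apply: sub_sigma_algebra.
rewrite /= openE => g Bg; apply: filterS (act_nbhs a g y) => h /= ->.
exact: Bg.
Qed.

Lemma mixture_sumZ (R : realType) T (s_ : nat -> seq ({nonneg R} * T)) n c f :
  mixture_sum s_ n (fun x => c * f x) = c * mixture_sum s_ n f.
Proof.
rewrite /mixture_sum mulr_sumr; apply: eq_bigr => i _; rewrite mulrCA.
by congr (_ * _); rewrite /avg mulr_sumr; apply: eq_bigr => p _; rewrite mulrCA.
Qed.

Lemma dense_act (G : topGroupType) (Y : choiceType) (a : continuous_action G Y)
    (d : nat -> G) : dense (range d) ->
  forall g (ys : seq Y), exists n, {in ys, forall y, a (d n) y = a g y}.
Proof.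
move=> dd g ys.
have [h [/interior_subset hU [n _ dn]]] :
    interior [set h | {in ys, forall y, a h y = a g y}] `&` range d !=set0.
  apply: dd; last exact: open_interior.
  exists g; elim: ys => [|y ys IH]; first exact: filterS filterT.
  apply: filterS (filterI (act_nbhs a g y) IH) => h [hy hys] z.
  by rewrite inE => /predU1P[->|/hys].
by exists n; rewrite dn.
Qed.

Lemma amenable_liouville (R : realType) (G : topGroupType) (Y : choiceType)
    (a : continuous_action G Y) (y0 : Y) (d : nat -> G) :
  (forall y, exists g, y = a g y0) -> dense (range d) ->
  amenable R G -> liouville R a.
Proof.
move=> tr dd amG.
have tr2 y z : exists g, z = a g y.
  have [g ->] := tr y; have [h ->] := tr z.
  by exists (h * g^-1)%g; rewrite -actM -mulgA mulVg mulg1.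
have da := dense_act a dd.
have /choice[pick Hpick] : forall x : seq (Y * Y) * nat,
    exists s : seq ({nonneg R} * G), [/\ is_distr s,
      almost_invariant a x.2.+1%:R^-1 x.1 s &
      exists2 p, p \in s & 0 < p.1%:num /\ p.2 = d x.2].
  by move=> [ps i]; apply: almost_invariant_charging amG tr2 da _; rewrite invr_gt0.
pose pk ps i := pick (ps, i).
have pk1 ps i : is_distr (pk ps i) by have [] := Hpick (ps, i).
have pk2 ps i : almost_invariant a i.+1%:R^-1 ps (pk ps i) by have [] := Hpick (ps, i).
pose s_ : nat -> seq ({nonneg R} * borel G) := stage a y0 d pk.
have s1 i : is_distr (s_ i) by exact: stage_distr.
exists (mixture_prob s1); split; last 2 first.
- exact: mixture_regular.
- move=> f [M fM] harm.
  have M0 : 0 <= M by rewrite (le_trans _ (fM y0)).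
  have M1 : 0 < M + 1 by rewrite ltr_pwDr.
  (* Rescaling into the unit ball; [M + 1] is positive even when [M = 0]. *)
  pose f' y := (M + 1)^-1 * f y.
  have f'1 y : `|f' y| <= 1.
    rewrite normrM ger0_norm ?invr_ge0 ?(ltW M1)// mulrC ler_pdivrMr// mul1r.
    by rewrite (le_trans (fM y))// lerDl.
  have harm' y : mixture_sum s_ k (fun g => f' (a g y)) @[k --> \oo] --> f' y.
    rewrite (_ : mixture_sum s_^~ _ = fun k =>
        (M + 1)^-1 * mixture_sum s_ k (fun g => f (a g y))).
      apply: cvgM; first exact: cvg_cst.
      rewrite (harm y); apply: integral_mixture_cvg.
        exact: orbit_map_measurable.
      by exists M => g; exact: fM.
    by apply/funext => k; rewrite mixture_sumZ.
  exists (f (a (d 0) y0)); apply/funext => y.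
  have [g ->] := tr y; have [n ->] : exists n, a g y0 = a (d n) y0.
    by have [n nE] := da g [:: y0]; exists n; rewrite nE ?mem_head.
  have := harmonic_const pk1 pk2 n 0 f'1 harm'.
  by move=> /mulfI; apply; rewrite invr_neq0// gt_eqF.
(* Every nonempty open set contains some [d n], which stage [n] charges; the support itself is
   therefore dense. *)
- move=> O O0 oO; have [x [Ox [n _ dn]]] := dd O O0 oO.
  exists x; split => // M [_]; apply.
  have [_ _ [p ps [p0 /= pE]]] :=
    Hpick (pairs (ball_at a y0 d n (letters a y0 d pk n)), n).
  by rewrite -dn -pE; exact: (@mixture_spt R G s_ s1 n p).
Qed.

(** * Groups of permutations *)

Section subgroup_of_sym.
Variables (X : choiceType) (G : groupClosed (Sym X)).
Implicit Types (g h : subgroup G) (U : set (subgroup G)).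

(** The sets containing all [h] that agree with [g] on some finite list form a filter; it converges
    to [g] pointwise, hence in [G]. *)
Lemma subgroup_nbhs g U : nbhs g U ->
  exists s : seq X, forall h, {in s, perm_of h =1 perm_of g} -> U h.
Proof.
pose F : set_system (subgroup G) :=
  [set V | exists s : seq X, forall h, {in s, perm_of h =1 perm_of g} -> V h].
suff: F --> g by apply.
have FF : Filter F.
  split; first by exists [::].
    move=> V W [s sV] [t tW]; exists (s ++ t) => h hst.
    by split; [apply: sV|apply: tW] => x xs; apply: hst; rewrite mem_cat xs ?orbT.
  by move=> V W VW [s sV]; exists s => h /sV/VW.
apply: subgroup_cvg; apply: sym_cvg => x; exists [:: x] => h hx.
exact: (hx x (mem_head _ _)).
Qed.

End subgroup_of_sym.

(** There are countably many finite partial maps of [X]; choose an element of [G] extending each one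
    that extends, and [1] for the others. *)
Lemma subgroup_separable (X : countType) (G : groupClosed (Sym X)) :
  exists d : nat -> subgroup G, dense (range d).
Proof.
pose ok (s : seq (X * X)) (h : subgroup G) := {in s, forall p, perm_of h p.1 = p.2}.
have /choice[c Hc] : forall s, exists h, (exists h', ok s h') -> ok s h.
  move=> s; have [[h hs]|n] := pselect (exists h', ok s h').
    by exists h.
  by exists 1%g.
exists (fun n : nat => c (odflt [::] (choice.unpickle n))) => O [g Og] oO.
have [s sO] := subgroup_nbhs (open_nbhs_nbhs (conj oO Og)).
pose t := [seq (x, perm_of g x) | x <- s].
exists (c t); split; last by exists (choice.pickle t) => //; rewrite choice.pickleK.
apply: sO => x xs.
by apply: (Hc t _ (x, perm_of g x)); [exists g => _ /mapP[y _ ->]|exact: map_f].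
Qed.

Section stabilizer.
Variables (X : choiceType) (G : groupClosed (Sym X)).

Lemma perm_ofM (g h : subgroup G) x : perm_of (g * h)%g x = perm_of g (perm_of h x).
Proof. by []. Qed.

Lemma perm_of1 x : perm_of (1%g : subgroup G) x = x.
Proof. by []. Qed.

Lemma perm_ofK (g : subgroup G) : cancel (perm_of g) (perm_of g^-1%g).
Proof. by move=> x; rewrite -perm_ofM mulVg. Qed.

(** A monotone [g] maps the sorted enumeration of [B] to a sorted enumeration of the same set, and
    there is only one. *)
Lemma fset_stabilizer (g : subgroup G) (B : {fset X}) :
  preserves_linear_order G -> fset_act g B = B -> {in B, forall x, perm_of g x = x}.
Proof.
move=> [le [_ anti tr tot mono]] gB.
pose s := sort le B.
have ss : sorted le s by exact: sort_sorted.
have gs : map (perm_of g) s = s.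
  apply: (sorted_eq tr anti) => //; first exact: homo_sorted (mono g) _ ss.
  apply: uniq_perm; rewrite ?map_inj_uniq ?sort_uniq ?fset_uniq//.
    exact: can_inj (perm_ofK g).
  move=> x; rewrite mem_sort -[in RHS]gB; apply/mapP/imfsetP => /= -[y yB ->].
    by exists y => //; move: yB; rewrite mem_sort.
  by exists y => //; rewrite mem_sort.
move=> x xB; have : x \in s by rewrite mem_sort.
by move: gs; rewrite -[RHS]map_id => /eq_in_map; apply.
Qed.

End stabilizer.

(** * Cesaro limits of Markov operators *)

Section markov_operator.
Variables (R : realType) (G : topGroupType) (Y : choiceType).
Variables (a : continuous_action G Y) (mu : probability (borel G) R).
Implicit Types (F : Y -> R) (y : Y).

Lemma orbit_integrable F y : bounded_real F ->
  mu.-integrable setT (EFin \o (fun g : borel G => F (a g y))).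
Proof.
move=> [M FM]; apply: bounded_integrable; first exact: orbit_map_measurable.
by exists M.
Qed.

Definition markov_op F y : R := \int[mu]_g F (a g y).

Lemma markov_cst c : markov_op (fun=> c) = fun=> c.
Proof. by apply/funext => y; exact: Rintegral_cst_prob. Qed.

Lemma markovD F F' : bounded_real F -> bounded_real F' ->
  markov_op (fun y => F y + F' y) = fun y => markov_op F y + markov_op F' y.
Proof.
move=> bF bF'; apply/funext => y; rewrite /markov_op RintegralD//.
  exact: orbit_integrable.
exact: orbit_integrable.
Qed.

Lemma markovZ c F : bounded_real F ->
  markov_op (fun y => c * F y) = fun y => c * markov_op F y.
Proof.
move=> bF; apply/funext => y; rewrite /markov_op RintegralZl//.
exact: orbit_integrable.
Qed.

(** The base points may differ because the final invariance argument compares a translated function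
    at one point of the orbit with the original one at another. *)
Lemma markov_near F F' y y' e : bounded_real F -> bounded_real F' ->
  (forall g, `|F (a g y) - F' (a g y')| <= e) ->
  `|markov_op F y - markov_op F' y'| <= e.
Proof.
move=> bF bF' FF; rewrite /markov_op -RintegralB//; try exact: orbit_integrable.
have [[M FM] [M' FM']] := (bF, bF').
have mD : measurable_fun setT (fun g : borel G => F (a g y) - F' (a g y')).
  by apply: measurable_funB; exact: orbit_map_measurable.
have iD : mu.-integrable setT (EFin \o (fun g : borel G => F (a g y) - F' (a g y'))).
  by apply: bounded_integrable => //; exists e.
apply: le_trans (le_normr_Rintegral _ iD) _ => //.
rewrite -[leRHS](Rintegral_cst_prob mu); apply: le_Rintegral => //.
  exact: (integrable_norm iD).
by apply: bounded_integrable => //; exists `|e|.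
Qed.

Lemma markov_bound F M : (forall y, `|F y| <= M) -> forall y, `|markov_op F y| <= M.
Proof.
move=> FM y; rewrite -[markov_op F y]subr0 -[X in _ - X](congr1 (@^~ y) (markov_cst 0)).
by apply: markov_near; [exists M|exists 0 => z; rewrite normr0|move=> g; rewrite subr0].
Qed.

Lemma iter_markov_bound F M k : (forall y, `|F y| <= M) ->
  forall y, `|iter k markov_op F y| <= M.
Proof. by move=> FM; elim: k => [|k IH] //=; exact: markov_bound. Qed.

Lemma iter_markov_bounded F k : bounded_real F -> bounded_real (iter k markov_op F).
Proof. by move=> [M FM]; exists M; exact: iter_markov_bound. Qed.

Lemma iter_markovD F F' k : bounded_real F -> bounded_real F' ->
  iter k markov_op (fun y => F y + F' y) =
  fun y => iter k markov_op F y + iter k markov_op F' y.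
Proof.
move=> bF bF'; elim: k => [//|k IH] /=.
by rewrite IH markovD//; exact: iter_markov_bounded.
Qed.

Lemma iter_markovZ c F k : bounded_real F ->
  iter k markov_op (fun y => c * F y) = fun y => c * iter k markov_op F y.
Proof.
move=> bF; elim: k => [//|k IH] /=.
by rewrite IH markovZ//; exact: iter_markov_bounded.
Qed.

Lemma iter_markov_near F F' y y' e k : bounded_real F -> bounded_real F' ->
  (forall g, `|F (a g y) - F' (a g y')| <= e) ->
  forall g, `|iter k markov_op F (a g y) - iter k markov_op F' (a g y')| <= e.
Proof.
move=> bF bF' FF; elim: k => [//|k IH] g /=.
apply: markov_near; try exact: iter_markov_bounded.
by move=> h; rewrite -!actM.
Qed.

Lemma iter_markov_ge0 F k : bounded_real F -> (forall y, 0 <= F y) ->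
  forall y, 0 <= iter k markov_op F y.
Proof.
move=> bF F0; elim: k => [//|k IH] y /=.
by apply: Rintegral_ge0 => g _.
Qed.

Definition cesaro_mean F n y : R := n.+1%:R^-1 * \sum_(k < n.+1) iter k markov_op F y.

Lemma cesaro_norm_le F F' n y y' e :
  (forall k, `|iter k markov_op F y - iter k markov_op F' y'| <= e) ->
  `|cesaro_mean F n y - cesaro_mean F' n y'| <= e.
Proof.
move=> FF; rewrite /cesaro_mean -mulrBr -sumrB normrM ger0_norm ?invr_ge0//.
rewrite ler_pdivrMl ?ltr0n//; apply: le_trans (ler_norm_sum _ _ _) _.
apply: (@le_trans _ _ (\sum_(k < n.+1) e)); first exact: ler_sum.
by rewrite sumr_const card_ord mulr_natl.
Qed.

Lemma cesaro_bound F M n : (forall y, `|F y| <= M) ->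
  forall y, `|cesaro_mean F n y| <= M.
Proof.
move=> FM y; rewrite /cesaro_mean normrM ger0_norm ?invr_ge0// ler_pdivrMl ?ltr0n//.
apply: le_trans (ler_norm_sum _ _ _) _.
apply: (@le_trans _ _ (\sum_(k < n.+1) M)); last first.
  by rewrite sumr_const card_ord mulr_natl.
by apply: ler_sum => k _; exact: iter_markov_bound.
Qed.

Lemma cesaro_bounded F y : bounded_real F -> bounded_real (fun n => cesaro_mean F n y).
Proof. by move=> [M FM]; exists M => n; exact: cesaro_bound. Qed.

Lemma markov_sum F n : bounded_real F ->
  markov_op (fun y => \sum_(k < n) iter k markov_op F y) =
  fun y => \sum_(k < n) iter k.+1 markov_op F y.
Proof.
move=> bF; elim: n => [|n IH].
  rewrite (_ : (fun y => \sum_(k < 0) _) = fun=> 0) ?markov_cst.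
    by apply/funext => y; rewrite big_ord0.
  by apply/funext => y; rewrite big_ord0.
rewrite (_ : (fun y => _) = fun y =>
    \sum_(k < n) iter k markov_op F y + iter n markov_op F y).
  rewrite markovD ?IH//; last exact: iter_markov_bounded.
    by apply/funext => y; rewrite big_ord_recr.
  have [M FM] := bF; exists (\sum_(k < n) M) => y.
  apply: le_trans (ler_norm_sum _ _ _) _.
  by apply: ler_sum => k _; exact: iter_markov_bound.
by apply/funext => y; rewrite big_ord_recr.
Qed.

(** Telescoping: the operator shifts the sum by one and leaves the two end terms. *)
Lemma markov_cesaro F n y : bounded_real F ->
  markov_op (cesaro_mean F n) y =
  cesaro_mean F n y + n.+1%:R^-1 * (iter n.+1 markov_op F y - F y).
Proof.
move=> bF; rewrite /cesaro_mean markovZ; last first.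
  have [M FM] := bF; exists (\sum_(k < n.+1) M) => z.
  apply: le_trans (ler_norm_sum _ _ _) _.
  by apply: ler_sum => k _; exact: iter_markov_bound.
rewrite markov_sum// -mulrDr; congr (_ * _).
by rewrite big_ord_recr [in RHS]big_ord_recl /=; ring.
Qed.

Definition cesaro_lim F y : R := ulim (fun n => cesaro_mean F n y).

Lemma cesaro_limD F F' y : bounded_real F -> bounded_real F' ->
  cesaro_lim (fun z => F z + F' z) y = cesaro_lim F y + cesaro_lim F' y.
Proof.
move=> bF bF'; rewrite /cesaro_lim -ulimD; try exact: cesaro_bounded.
congr ulim; apply/funext => n.
rewrite /cesaro_mean /= -mulrDr -big_split /=; congr (_ * _).
by apply: eq_bigr => k _; rewrite iter_markovD.
Qed.

Lemma cesaro_limZ c F y : bounded_real F ->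
  cesaro_lim (fun z => c * F z) y = c * cesaro_lim F y.
Proof.
move=> bF; rewrite /cesaro_lim -ulimZ; last exact: cesaro_bounded.
congr ulim; apply/funext => n.
rewrite /cesaro_mean [RHS]mulrCA; congr (_ * _); rewrite mulr_sumr.
by apply: eq_bigr => k _; rewrite iter_markovZ.
Qed.

Lemma cesaro_lim_ge0 F y : bounded_real F -> (forall z, 0 <= F z) ->
  0 <= cesaro_lim F y.
Proof.
move=> bF F0; apply: ulim_ge; first exact: cesaro_bounded.
near=> n; rewrite mulr_ge0 ?invr_ge0// sumr_ge0// => k _.
exact: iter_markov_ge0.
Unshelve. all: by end_near. Qed.

Lemma cesaro_lim_cst c y : cesaro_lim (fun=> c) y = c.
Proof.
rewrite -[RHS](@ulim_cst R); congr ulim; apply/funext => n.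
rewrite /cesaro_mean (eq_bigr (fun=> c)) => [|k _].
  by rewrite sumr_const card_ord -[c *+ _]mulr_natl mulKf ?pnatr_eq0.
by elim: (val k) => //= j IH; rewrite (_ : iter j _ _ = fun=> c) ?markov_cst//;
  elim: j {IH} => //= j ->; rewrite markov_cst.
Qed.

Lemma cesaro_lim_bound F M y : (forall z, `|F z| <= M) -> `|cesaro_lim F y| <= M.
Proof.
move=> FM; apply: ulim_norm_le; first by apply: cesaro_bounded; exists M.
by near=> n; exact: cesaro_bound.
Unshelve. all: by end_near. Qed.

Lemma cesaro_lim_near F F' y y' e : bounded_real F -> bounded_real F' ->
  (forall g, `|F (a g y) - F' (a g y')| <= e) ->
  `|cesaro_lim F y - cesaro_lim F' y'| <= e.
Proof.
move=> bF bF' FF.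
have [bc bc'] := (cesaro_bounded y bF, cesaro_bounded y' bF').
rewrite /cesaro_lim -ulimB//; apply: ulim_norm_le.
  have [[M FM] [M' FM']] := (bc, bc'); exists (M + M') => n.
  by apply: le_trans (ler_normB _ _) _; apply: lerD.
near=> n; apply: cesaro_norm_le => k.
by have := iter_markov_near k bF bF' FF 1%g; rewrite !act1.
Unshelve. all: by end_near. Qed.

End markov_operator.

(** * Harmonicity of Cesaro ultralimits *)

Section ultralimit_harmonic.
Variables (R : realType) (G : topGroupType) (Y : choiceType).
Variables (a : continuous_action G Y) (mu : probability (borel G) R).
Variables (c : Y -> nat) (c_inj : injective c).

Lemma orbit_set_measurable (Q : set Y) y :
  measurable ([set g | Q (a g y)] : set (borel G)).
Proof.
apply: sub_sigma_algebra; rewrite /= openE => g Qg.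
by apply: filterS (act_nbhs a g y) => h /= ->.
Qed.

(** Continuity from above: the tails of the coding [c] decrease to the empty set. *)
Lemma orbit_tail_small y (e : R) : 0 < e ->
  exists j, \int[mu]_g \1_[set z | (j <= c z)%N] (a g y) <= e.
Proof.
move=> e0.
pose T j : set (borel G) := [set g | (j <= c (a g y))%N].
have mT j : measurable (T j) by exact: (orbit_set_measurable [set z | (j <= c z)%N]).
have T0 : \bigcap_j T j = set0.
  by rewrite -subset0 => g /(_ (c (a g y)).+1 I) /=; rewrite /T /= ltnn.
have : mu \o T @ \oo --> mu (\bigcap_j T j).
  apply: nonincreasing_cvg_mu => //.
  - by rewrite (le_lt_trans (probability_le1 _ _))// ltry.
  - by rewrite T0.
  - by move=> i j ij; apply/subsetPset => g; exact: leq_trans.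
rewrite T0 measure0 => /fine_cvgP[_] /cvgrPdist_le /(_ e e0) [j _ /(_ j (leqnn j))].
rewrite /= sub0r normrN => hj; exists j; apply: le_trans hj; apply: le_trans (ler_norm _).
rewrite /Rintegral le_eqVlt; apply/orP; left; apply/eqP; congr fine.
rewrite -(setIT (T j)) -(integral_indic mu measurableT (mT j)).
by apply: eq_integral => g _; rewrite !indicE.
Qed.

(* Ultralimits do not commute with integrals in general; here up to [e] the
   measure lives on finitely many fibres of [g |-> a g y]. *)
Lemma ulim_markov (F : nat -> Y -> R) M y :
  (forall n z, `|F n z| <= M) ->
  ulim (fun n => markov_op a mu (F n) y) =
  markov_op a mu (fun z => ulim (fun n => F n z)) y.
Proof.
move=> FM; apply: ulim_eq; set L := fun z => ulim _.
have bF z : bounded_real (fun n => F n z) by exists M.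
have LM z : `|L z| <= M by apply: ulim_norm_le => //; near=> n; exact: FM.
have M0 : 0 <= M by rewrite (le_trans _ (FM 0 y)).
apply/cvgrPdist_le => e e0.
(* Codes below [j] contribute at most [e'], and the tail, of mass at most [e'], at most
   [(M + M) * e']; the total is [e]. *)
pose e' := e / (1 + (M + M)).
have e'0 : 0 < e' by rewrite divr_gt0// ltr_wpDr// addr_ge0.
have [j hj] := orbit_tail_small y e'0.
(* Each of the [j] codes belongs to at most one point, so this is a finite intersection of sets of
   the ultrafilter. *)
have near_fin : \forall n \near ultra_nat, forall k : 'I_j,
    forall z, c z = k -> `|L z - F n z| <= e'.
  apply: filter_forall => k.
  have [[z zk]|nz] := pselect (exists z, c z = k); last first.
    by near=> n => z zk; exfalso; apply: nz; exists z.
  have /cvgrPdist_le /(_ e' e'0) := ulim_cvg (bF z).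
  by apply: filterS => n hn z' z'k; have <- : z = z' by apply: c_inj; rewrite zk z'k.
apply: filterS near_fin => n hn.
pose ind z : R := \1_[set z | (j <= c z)%N] z.
have bind : bounded_real ind.
  by exists 1 => z; rewrite /ind indicE; case: (_ \in _); rewrite ?normr1 ?normr0.
have bL : bounded_real L by exists M.
have bFn : bounded_real (F n) by exists M.
have bR : bounded_real (fun z => e' + (M + M) * ind z).
  have [N Nind] := bind; exists (`|e'| + `|M + M| * N) => z.
  apply: le_trans (ler_normD _ _) _; rewrite lerD2l normrM ler_wpM2l//.
have pw z : `|L z - F n z| <= e' + (M + M) * ind z.
  rewrite /ind indicE; have [cz|cz] := leqP j (c z).
    rewrite mem_set//= mulr1; apply: le_trans (ler_normB _ _) _.
    by rewrite ler_wpDl ?(ltW e'0)// lerD.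
  rewrite memNset ?mulr0 ?addr0 /= -?ltnNge ?cz//; last by apply/negP; rewrite -ltnNge.
  exact: (hn (Ordinal cz)).
rewrite /markov_op -RintegralB//; try exact: orbit_integrable.
have iD : mu.-integrable setT (EFin \o (fun g : borel G => L (a g y) - F n (a g y))).
  apply: (orbit_integrable a mu y (F := fun z => L z - F n z)).
  by exists (M + M) => z; apply: le_trans (ler_normB _ _) _; apply: lerD.
apply: le_trans (le_normr_Rintegral _ iD) _ => //.
apply: (@le_trans _ _ (markov_op a mu (fun z => e' + (M + M) * ind z) y)).
  apply: le_Rintegral => //; first exact: (integrable_norm iD).
  exact: (orbit_integrable a mu y bR).
rewrite markovD; last 2 first.
- by exists `|e'|.
- have [N Nind] := bind; exists (`|M + M| * N) => z.
  by rewrite normrM ler_wpM2l.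
rewrite (@markovZ _ _ _ a mu (M + M) ind bind) markov_cst.
apply: (@le_trans _ _ (e' + (M + M) * e')).
  by rewrite lerD2l ler_wpM2l// addr_ge0.
by rewrite -[X in X + _]mul1r -mulrDl mulrC divfK// gt_eqF// ltr_wpDr// addr_ge0.
Unshelve. all: by end_near. Qed.

(** The operator commutes with the ultralimit and moves the Cesaro mean by at most
    [2 * M / (n + 1)], which tends to 0. *)
Lemma cesaro_lim_harmonic F : bounded_real F ->
  mu_harmonic a mu (cesaro_lim a mu F).
Proof.
move=> bF y.
rewrite -[RHS]/(markov_op a mu (fun z => ulim (fun n => cesaro_mean a mu F n z)) y).
have [M FM] := bF.
rewrite -(@ulim_markov _ M); last by move=> n z; exact: cesaro_bound.
rewrite (_ : (fun n => _) = fun n => cesaro_mean a mu F n y +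
    n.+1%:R^-1 * (iter n.+1 (markov_op a mu) F y - F y)); last first.
  by apply/funext => n; exact: markov_cesaro.
have c0 : n.+1%:R^-1 * (iter n.+1 (markov_op a mu) F y - F y) @[n --> \oo] --> (0 : R).
  apply/cvgr0Pnorm_le => e e0.
  have M0 : 0 <= M by rewrite (le_trans _ (FM y)).
  have h : (M + M) * n.+1%:R^-1 @[n --> \oo] --> (0 : R).
    rewrite -[X in _ --> X](mulr0 (M + M)); apply: cvgM; first exact: cvg_cst.
    exact: cvg_harmonic.
  move/cvgr0Pnorm_le: h => /(_ e e0); apply: filterS => n; apply: le_trans.
  rewrite !normrM mulrC ler_wpM2r// [leRHS]ger0_norm ?addr_ge0//.
  apply: le_trans (ler_normB _ _) _; apply: lerD => //.
  exact: iter_markov_bound.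
rewrite ulimD.
- by rewrite (ulim_oo c0) addr0.
- exact: cesaro_bounded.
exists (M + M) => n; rewrite normrM ger0_norm ?invr_ge0//.
apply: (@le_trans _ _ (1 * (M + M))); last by rewrite mul1r.
apply: ler_pM; rewrite ?invr_ge0// ?invf_le1 ?ler1n//.
apply: le_trans (ler_normB _ _) _; apply: lerD => //.
exact: iter_markov_bound.
Qed.

Lemma cesaro_lim_liouville F y z : mu_liouville a mu -> bounded_real F ->
  cesaro_lim a mu F y = cesaro_lim a mu F z.
Proof.
move=> li bF; have [|r ->//] := li _ _ (cesaro_lim_harmonic bF).
by have [M FM] := bF; exists M => w; exact: cesaro_lim_bound.
Qed.

End ultralimit_harmonic.

(** * Means on complex functions from means on real functions *)

Section complex_extension.
Variables (R : realType) (G : topGroupType) (m : (G -> R) -> R).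
Local Open Scope complex_scope.
Implicit Types (f : RUCB R G).

Definition real_ruc (u : G -> R) := forall e : R, 0 < e ->
  exists2 U : set G, nbhs (1%g : G) U &
    forall x y : G, U (x * y^-1)%g -> `|u x - u y| <= e.

Lemma norm_Re_le (z : R[i]) (M : R) : `|z| <= M%:C -> `|complex.Re z| <= M.
Proof. by move=> zM; rewrite -lecR (le_trans _ zM)// normc_ge_Re. Qed.

Lemma norm_Im_le (z : R[i]) (M : R) : `|z| <= M%:C -> `|complex.Im z| <= M.
Proof.
rewrite normc_def lecR; apply: le_trans.
by rewrite -sqrtr_sqr ler_wsqrtr// lerDr sqr_ge0.
Qed.

Lemma rucb_Re_bounded f : bounded_real (fun x => complex.Re (f x)).
Proof.
by have /asboolP[_ [M fM]] := valP f; exists M => x; exact: norm_Re_le (fM x).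
Qed.

Lemma rucb_Im_bounded f : bounded_real (fun x => complex.Im (f x)).
Proof.
by have /asboolP[_ [M fM]] := valP f; exists M => x; exact: norm_Im_le (fM x).
Qed.

Lemma rucb_Re_ruc f : real_ruc (fun x => complex.Re (f x)).
Proof.
have /asboolP[cf _] := valP f; move=> e /cf[U U1 Uf]; exists U => // x y /Uf.
by move/norm_Re_le; rewrite raddfB.
Qed.

Lemma rucb_Im_ruc f : real_ruc (fun x => complex.Im (f x)).
Proof.
have /asboolP[cf _] := valP f; move=> e /cf[U U1 Uf]; exists U => // x y /Uf.
by move/norm_Im_le; rewrite raddfB.
Qed.

Hypothesis mD : forall u v, bounded_real u -> bounded_real v ->
  m (fun x => u x + v x) = m u + m v.
Hypothesis mZ : forall c u, bounded_real u -> m (fun x => c * u x) = c * m u.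
Hypothesis m_ge0 : forall u, bounded_real u -> (forall x, 0 <= u x) -> 0 <= m u.
Hypothesis m1 : m (fun=> 1) = 1.
Hypothesis m_inv : forall u g, bounded_real u -> real_ruc u ->
  m (fun x => u (g * x)%g) = m u.

Definition complex_mean f : R[i] :=
  m (fun x => complex.Re (f x)) +i* m (fun x => complex.Im (f x)).

Lemma bounded_realZ c (u : G -> R) : bounded_real u -> bounded_real (fun x => c * u x).
Proof. by move=> [M uM]; exists (`|c| * M) => x; rewrite normrM ler_wpM2l. Qed.

Fact complex_mean_linear : GRing.linear_for *%R complex_mean.
Proof.
move=> [b c] f h; rewrite /complex_mean.
have fhE x : ((b +i* c) *: f + h) x = (b +i* c) * f x + h x :> R[i] by [].
have [rf if_] := (rucb_Re_bounded f, rucb_Im_bounded f).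
have [rh ih] := (rucb_Re_bounded h, rucb_Im_bounded h).
have bD u v : bounded_real u -> bounded_real v -> bounded_real (fun x : G => u x + v x).
  move=> [M uM] [N vN]; exists (M + N) => x.
  by apply: le_trans (ler_normD _ _) _; exact: lerD.
have -> : (fun x => complex.Re (((b +i* c) *: f + h) x)) =
    fun x => (b * complex.Re (f x) + (- c) * complex.Im (f x)) + complex.Re (h x).
  by apply/funext => x; rewrite fhE; case: (f x) (h x) => [u v] [s t] /=; rewrite mulNr.
have -> : (fun x => complex.Im (((b +i* c) *: f + h) x)) =
    fun x => (b * complex.Im (f x) + c * complex.Re (f x)) + complex.Im (h x).
  by apply/funext => x; rewrite fhE; case: (f x) (h x) => [u v] [s t] /=.
rewrite !mD ?mZ//; try (apply: bD); try exact: bounded_realZ.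
by apply/eqP; rewrite eq_complex /= mulNr !eqxx.
Qed.

Lemma amenable_of_real_mean : amenable R G.
Proof.
pose mu : {scalar RUCB R G} := HB.pack complex_mean
  (GRing.isLinear.Build R[i] (RUCB R G) R[i]^o *%R complex_mean complex_mean_linear).
exists mu.
  split.
    move=> f f0; rewrite /= /complex_mean.
    (* Zero is written [0 * 0] so that homogeneity [mZ] gives the zero function mean 0. *)
    have im0 : (fun x => complex.Im (f x)) = fun=> 0 * 0.
      apply/funext => x; have := f0 x; rewrite mul0r.
      by case: (f x) => u v; rewrite lecE /= => /andP[/eqP].
    have re0 x : 0 <= complex.Re (f x).
      by have := f0 x; case: (f x) => u v; rewrite lecE /= => /andP[].
    rewrite lecE /= im0 mZ; last by exists 0 => x; rewrite normr0.
    by rewrite mul0r eqxx m_ge0//; exact: rucb_Re_bounded.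
  rewrite /= /complex_mean /= m1 -[in m _](mul0r 0).
  rewrite (mZ 0 (u := fun=> 0)) ?mul0r//.
  by exists 0 => x; rewrite normr0.
move=> f g; rewrite /= /complex_mean /=.
rewrite (m_inv g (rucb_Re_bounded f) (@rucb_Re_ruc f)).
by rewrite (m_inv g (rucb_Im_bounded f) (@rucb_Im_ruc f)).
Qed.

End complex_extension.

(** * Exhaustion by finite sets and sections of the orbit maps *)

Lemma fset_exhaustion (X : countType) :
  exists B : nat -> {fset X}, forall s : seq X,
    exists N, forall n, (N <= n)%N -> {subset s <= B n}.
Proof.
exists (fun n => [fset x in pmap (@choice.unpickle X) (iota 0 n)]%fset).
elim=> [|x s [N sN]]; first by exists 0.
exists (maxn N (choice.pickle x).+1) => n; rewrite geq_max => /andP[Nn xn] y.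
rewrite inE => /predU1P[->|/(sN n Nn)//].
rewrite inE mem_pmap; apply/mapP; exists (choice.pickle x).
  by rewrite mem_iota.
by rewrite choice.pickleK.
Qed.

Section liouville_amenable.
Variables (R : realType) (X : countType) (G : groupClosed (Sym X)).
Hypothesis ordG : preserves_linear_order G.

Section orbit.
Variable B : {fset X}.
Local Notation a := (orbit_action (fset_action G) B).
Local Notation Y := (act_orbit (fset_action G) B).

Fact orbit_base_proof : `[< exists g, B = fset_action G g B >].
Proof. by apply/asboolP; exists 1%g; rewrite act1. Qed.

Definition orbit_base : Y := MkOrbit orbit_base_proof.

Lemma orbit_section_ex : exists sigma : Y -> subgroup G,
  forall y, a (sigma y) orbit_base = y.
Proof.
have /choice[sigma sE] : forall y : Y, exists g, a g orbit_base = y.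
  by move=> y; have /asboolP[g gE] := valP y; exists g; apply: val_inj.
by exists sigma.
Qed.

Lemma orbit_code_inj : injective (fun y : Y => choice.pickle (val y)).
Proof. by move=> y z /(pcan_inj choice.pickleK)/val_inj. Qed.

(** The invariant order enters here: [g^-1 * h] fixes [B] as a set, hence point by point. *)
Lemma orbit_base_stabilizer g h : a g orbit_base = a h orbit_base ->
  {in B, forall x, perm_of (g^-1 * h)%g x = x}.
Proof.
move=> /(congr1 val)/= gh; apply: fset_stabilizer ordG _.
by rewrite fset_actM -[fset_act h B]gh -fset_actM mulVg fset_act1.
Qed.

(* For [u] right-uniformly continuous and [F y := u (sigma y)^-1], this compares
   the function attached to the translate [u (h * _)] at the point [x B] with [F]
   at the point [x h^-1 B]. *)
Lemma section_shift sigma (h x : subgroup G) :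
  (forall y, a (sigma y) orbit_base = y) ->
  {in B, forall t, perm_of h^-1%g t \in B ->
    perm_of (h * (sigma (a x orbit_base))^-1 *
             ((sigma (a x (a h^-1 orbit_base)))^-1)^-1)%g t = t}.
Proof.
move=> sE t tB htB; set p := sigma _; set q := sigma _.
have /orbit_base_stabilizer pE : a p orbit_base = a x orbit_base by rewrite sE.
have /orbit_base_stabilizer qE : a (x * h^-1)%g orbit_base = a q orbit_base.
  by rewrite sE actM.
(* Regrouped so that the last factor fixes [t] and [p^-1 * x] fixes [h^-1 t], both points being in
   [B]; what remains is [h * h^-1]. *)
have -> : (h * p^-1 * q^-1^-1 = h * (p^-1 * x) * h^-1 * ((x * h^-1)^-1 * q))%g.
  by rewrite invgK invgM invgK !mulgA mulgVK mulgK.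
rewrite perm_ofM qE// perm_ofM perm_ofM pE// -perm_ofM mulgV.
exact: perm_of1.
Qed.

End orbit.
End liouville_amenable.

(** * The theorem *)

Lemma liouville_amenable (R : realType) (X : countType) (G : groupClosed (Sym X)) :
  preserves_linear_order G ->
  (forall B : {fset X}, liouville R (orbit_action (fset_action G) B)) ->
  amenable R (subgroup G).
Proof.
move=> ordG li.
have [B BP] := fset_exhaustion X.
have /choice[nu nuP] : forall n, exists nu : probability (borel (subgroup G)) R,
    mu_liouville (orbit_action (fset_action G) (B n)) nu.
  by move=> n; have [nu [_ _ nuL]] := li (B n); exists nu.
pose sigma n := projT1 (cid (orbit_section_ex G (B n))).
pose a n := orbit_action (fset_action G) (B n).
have sE n : forall y, a n (sigma n y) (orbit_base G (B n)) = y
  := projT2 (cid (orbit_section_ex G (B n))).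
(* At [y = x^-1 B], the product [x * sigma y] stabilizes [B]; so for uniformly continuous [u] and
   large [B] this value is close to [u x]. *)
pose T n (u : subgroup G -> R) y := u (sigma n y)^-1%g.
have bT n u : bounded_real u -> bounded_real (T n u).
  by move=> [M uM]; exists M => y; exact: uM.
pose mn n u := cesaro_lim (a n) (nu n) (T n u) (orbit_base G (B n)).
have bmn u : bounded_real u -> bounded_real (fun n => mn n u).
  by move=> [M uM]; exists M => n; apply: cesaro_lim_bound => y; exact: uM.
apply: (@amenable_of_real_mean R _ (fun u => ulim (fun n => mn n u))).
- move=> u v bu bv; rewrite -ulimD; try exact: bmn.
  by congr ulim; apply/funext => n; rewrite -cesaro_limD//; exact: bT.
- move=> c u bu; rewrite -ulimZ; last exact: bmn.
  by congr ulim; apply/funext => n; rewrite -cesaro_limZ//; exact: bT.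
- move=> u bu u0; apply: ulim_ge; first exact: bmn.
  near=> n; apply: cesaro_lim_ge0; first exact: bT.
  by move=> y; exact: u0.
- rewrite -[RHS](@ulim_cst R); congr ulim; apply/funext => n.
  exact: cesaro_lim_cst.
move=> u h bu ru.
have bhu : bounded_real (fun x => u (h * x)%g).
  by have [M uM] := bu; exists M => x; exact: uM.
apply/eqP; rewrite -subr_eq0 -normr_le0; apply/ler_addgt0Pr => e e0; rewrite add0r.
rewrite -ulimB; [|exact: bmn|exact: bmn].
apply: ulim_norm_le.
  have [[M uM] [N vN]] := (bmn _ bhu, bmn _ bu); exists (M + N) => n.
  by apply: le_trans (ler_normB _ _) _; apply: lerD.
have [U U1 Uu] := ru e e0; have [s sU] := subgroup_nbhs U1.
(* [section_shift] needs both [t] and [h^-1 t] in [B n] for each [t] in [s]. *)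
have [N NP] := BP (s ++ [seq perm_of h^-1%g t | t <- s]).
exists N => // n /= /NP sB.
(* The Liouville property lets the base point for [u] move to [h^-1 B n], which absorbs the
   translation by [h]. *)
rewrite {2}/mn (cesaro_lim_liouville (@orbit_code_inj X G (B n)) (orbit_base G (B n))
  (a n h^-1%g (orbit_base G (B n))) (nuP n) (bT n u bu)).
apply: cesaro_lim_near; [exact: bT|exact: bT|move=> x].
apply: Uu; apply: sU => t ts; rewrite perm_of1.
have := @section_shift X G ordG (B n) (sigma n) h x (sE n) t. apply.
  by apply: sB; rewrite mem_cat ts.
by apply: sB; rewrite mem_cat map_f ?orbT.
Unshelve. all: by end_near. Qed.

Theorem corollary6p2 (R : realType) (X : countType) (G : groupClosed (Sym X)) :
  (amenable R (subgroup G) ->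
     forall B : {fset X}, liouville R (orbit_action (fset_action G) B)) /\
  (preserves_linear_order G ->
     (forall B : {fset X}, liouville R (orbit_action (fset_action G) B)) ->
     amenable R (subgroup G)).
Proof.
split; last exact: liouville_amenable.
move=> amG B; have [d dd] := subgroup_separable G.
apply: (amenable_liouville (y0 := orbit_base G B) _ dd amG) => y.
by have [sigma sE] := orbit_section_ex G B; exists (sigma y); rewrite sE.
Qed.
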